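(* For any feasible tie-breaking functions, and for each number of candidates $j<5$, weighted constructive coalitional manipulation is solvable in polynomial time for ranked pairs (under the given tie-breaking functions), in both the nonunique-winner model and the unique-winner model.
   Context: An election consists of a finite candidate set $C$ and a collection of voters, each casting a tie-free linear order over $C$ and having a nonnegative integer weight. WMG: for distinct $c,d$, $D(c,d)$ = total weight of voters preferring $c$ to $d$ minus total weight preferring $d$ to $c$. Ranked pairs uses two feasible (polynomial-time computable) tie-breaking functions, a linear order on candidates and a linear order on unordered pairs of candidates: repeatedly take the not-yet-considered unordered pair $\{a,b\}$ with greatest $\max(D(a,b),D(b,a))$ (ties by the pair order); discard it if its relative order is already transitively implied by fixed orders, else fix the candidate with positive edge above the other (zero edges: candidate order decides); the top of the resulting linear order is the unique winner. Weighted constructive coalitional manipulation: given $C$ (here with $\|C\|=j$), weighted nonmanipulative voters $V$ with their votes, a collection $W$ of weighted manipulators (votes not yet set), and a distinguished $p\in C$: can tie-free linear-order votes be assigned to $W$ so that $p$ is a winner (nonunique-winner model) / the unique winner (unique-winner model) of the election with voters $V\cup W$? *)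

(* Defs.v *)
From HB Require Import structures.
From mathcomp Require Import all_boot all_order all_algebra.
Import Order.TTheory GRing.Theory Num.Theory.

Definition letter := 'I_3.
Definition l0 : letter := @Ordinal 3 0 isT.
Definition l1 : letter := @Ordinal 3 1 isT.
Definition lsep : letter := @Ordinal 3 2 isT.

Inductive move := MLeft | MRight | MStay.

Record TM := {
  tm_state : finType;
  tm_sym : finType;
  tm_start : tm_state;
  tm_halt : tm_state -> bool;
  tm_blank : tm_sym;
  tm_in : letter -> tm_sym;
  tm_out : tm_sym -> option letter;
  tm_delta : tm_state -> tm_sym -> tm_state * tm_sym * move }.

Set Implicit Arguments. Unset Strict Implicit. Unset Printing Implicit Defensive.

(* configuration: state, reversed left part, head cell, right part *)
Definition cfg (M : TM) :=
  (tm_state M * seq (tm_sym M) * tm_sym M * seq (tm_sym M))%type.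

Definition tm_step (M : TM) (c : cfg M) : cfg M :=
  let: (q, l, h, r) := c in
  if tm_halt M q then c else
  let: (q', s, m) := tm_delta M q h in
  match m with
  | MStay => (q', l, s, r)
  | MLeft => match l with
             | [::] => (q', [::], tm_blank M, s :: r)
             | x :: l' => (q', l', x, s :: r) end
  | MRight => match r with
             | [::] => (q', s :: l, tm_blank M, [::])
             | x :: r' => (q', s :: l, x, r') end
  end.

Definition tm_init (M : TM) (x : seq letter) : cfg M :=
  match map (tm_in M) x with
  | [::] => (tm_start M, [::], tm_blank M, [::])
  | y :: ys => (tm_start M, [::], y, ys)
  end.

Fixpoint read_out (M : TM) (s : seq (tm_sym M)) : seq letter :=
  match s with
  | [::] => [::]
  | y :: ys => match tm_out M y with
               | Some a => a :: read_out ys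
               | None => [::] end
  end.

Definition tm_output (M : TM) (c : cfg M) : seq letter :=
  let: (_, _, h, r) := c in read_out (h :: r).

Definition tm_state_of (M : TM) (c : cfg M) : tm_state M :=
  let: (q, _, _, _) := c in q.

Definition runs_to (M : TM) (x y : seq letter) (t : nat) : Prop :=
  let c := iter t (@tm_step M) (@tm_init M x) in
  tm_halt M (@tm_state_of M c) /\ @tm_output M c = y.

Definition poly_computable (X Y : Type) (dom : X -> Prop)
  (encX : X -> seq letter) (encY : Y -> seq letter) (f : X -> Y) : Prop :=
  exists (M : TM) (c k : nat), forall x, dom x ->
    runs_to M (encX x) (encY (f x)) (c * (size (encX x)) ^ k + c).

Definition enc_bool (b : bool) : seq letter := [:: if b then l1 else l0].

Definition poly_decidable (X : Type) (dom : X -> Prop)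
  (encX : X -> seq letter) (P : X -> Prop) : Prop :=
  exists (M : TM) (c k : nat), forall x, dom x ->
    exists b : bool, runs_to M (encX x) (enc_bool b) (c * (size (encX x)) ^ k + c)
                     /\ (b <-> P x).

Fixpoint bin (fuel n : nat) : seq bool :=
  match fuel with
  | 0 => [::]
  | f.+1 => if n == 0 then [::] else odd n :: bin f n./2
  end.

Definition enc_nat (n : nat) : seq letter :=
  map (fun b : bool => if b then l1 else l0) (bin n n) ++ [:: lsep].

Definition enc_nats (s : seq nat) : seq letter := flatten (map enc_nat s).

Definition enc_pairs (s : seq (nat * nat)) : seq letter :=
  enc_nats (flatten [seq [:: x.1; x.2] | x <- s]).

(* Candidates are natural numbers (names); a vote is a seq listing the
   candidates from most to least preferred; a voter is (weight, vote). *)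
Definition prefers (v : seq nat) (a b : nat) : bool := index a v < index b v.

Definition wmg (E : seq (nat * seq nat)) (a b : nat) : int :=
  \sum_(x <- E) ((if prefers x.2 a b then x.1 else 0)%:Z
                 - (if prefers x.2 b a then x.1 else 0)%:Z).

(* unordered pairs {a,b} represented by (min, max) *)
Definition upair (x : nat * nat) : nat * nat := (minn x.1 x.2, maxn x.1 x.2).

Definition allupairs (C : seq nat) : seq (nat * nat) :=
  [seq (a, b) | a <- C, b <- [seq b <- C | a < b]].

Fixpoint reach (E : seq (nat * nat)) (k : nat) (a b : nat) : bool :=
  match k with
  | 0 => false
  | k'.+1 => has (fun e => (e.1 == a) && ((e.2 == b) || reach E k' e.2 b)) E
  end.

Definition above (E : seq (nat * nat)) (a b : nat) : bool := reach E (size E) a b.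

Section RankedPairs.
Variables (C : seq nat) (E : seq (nat * seq nat))
          (ordC : seq nat) (ordP : seq (nat * nat)).
(* ordC : candidate tie-breaking order (earlier = higher priority)
   ordP : pair tie-breaking order (earlier = considered first) *)

Definition rp_strength (x : nat * nat) : int :=
  Num.max (wmg E x.1 x.2) (wmg E x.2 x.1).

Definition rp_pairpos (x : nat * nat) : nat := index (upair x) (map upair ordP).

Definition rp_before (x y : nat * nat) : bool :=
  (rp_strength y < rp_strength x)%R ||
  ((rp_strength x == rp_strength y) && (rp_pairpos x <= rp_pairpos y)).

Definition rp_sorted_pairs : seq (nat * nat) := sort rp_before (allupairs C).

Definition rp_step (F : seq (nat * nat)) (x : nat * nat) : seq (nat * nat) :=
  let: (a, b) := x in
  if above F a b || above F b a then F
  else if (0 < wmg E a b)%R then (a, b) :: F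
  else if (0 < wmg E b a)%R then (b, a) :: F
  else (if index a ordC < index b ordC then (a, b) else (b, a)) :: F.

Definition rp_fixed : seq (nat * nat) := foldl rp_step [::] rp_sorted_pairs.

Definition rp_winners : seq nat :=
  [seq c <- C | ~~ has (fun d => above rp_fixed d c) C].
End RankedPairs.

Record inst := Inst {
  icands : seq nat;
  ivoters : seq (nat * seq nat);
  imanip : seq nat;                 (* W : weights of manipulators *)
  idist : nat }.

Definition wf_inst (j : nat) (I : inst) : Prop :=
  [/\ uniq (icands I), size (icands I) = j,
      all (fun x => perm_eq x.2 (icands I)) (ivoters I) & idist I \in icands I].

Definition enc_inst (I : inst) : seq letter :=
  enc_nats ([:: size (icands I)] ++ icands I ++ [:: idist I; size (ivoters I)]
            ++ flatten [seq x.1 :: x.2 | x <- ivoters I]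
            ++ (size (imanip I) :: imanip I)).

Inductive winner_model := NonUnique | Unique.

Definition manipulable (tbC : seq nat -> seq nat) (tbP : seq nat -> seq (nat * nat))
  (m : winner_model) (I : inst) : Prop :=
  exists Wv : seq (seq nat),
    [/\ size Wv = size (imanip I),
        all (fun v => perm_eq v (icands I)) Wv &
        let ws := rp_winners (icands I) (ivoters I ++ zip (imanip I) Wv)
                    (tbC (icands I)) (tbP (icands I)) in
        match m with
        | NonUnique => idist I \in ws
        | Unique => ws = [:: idist I]
        end].

(* Main.v *)
Require Import Defs.
From mathcomp Require Import all_boot all_order all_algebra zify.
From Stdlib Require Import Classical_Prop Relation_Operators.
Import Order.TTheory GRing.Theory Num.Theory.

(** Let L be the ranking that ranked pairs outputs after a successful manipulation.  By
    Zavist and Tideman's characterization, L is the only stack: wherever it places [a]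
    above [b] against the edge between them, a chain of earlier edges along L implies
    [a] above [b].  Letting all manipulators vote L raises margins only in the direction
    of L, so L remains a stack, hence the outcome; therefore only unanimous votes of the
    coalition need to be tried.

    Under the unanimous vote L the outcome is determined by finitely many bits, once the
    number of candidates is fixed: the positions of the candidates in the two
    tie-breaking orders, the position of p, and the comparisons between the numbers
    N(a,b) + e w, where N(a,b) is the weight of the nonmanipulators preferring a to b, w
    is the weight of the coalition and e is 0 or 1.

    These bits are computed in polynomial time by a structured program acting on finitely
    many stacks, which is compiled to a single-tape Turing machine whose tape carries one
    track per stack.  All numbers are held in one stack of bit columns, so that each
    arithmetic operation is a finite-state pass over that stack reading one number from
    the input.  What remains is a function on a finite set, and needs no algorithm. *)

Set Implicit Arguments. Unset Strict Implicit. Unset Printing Implicit Defensive.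

(** * Transitive closure of a list of edges *)

Lemma clos_trans_sub T (R R' : T -> T -> Prop) x y :
  (forall x y, R x y -> R' x y) -> (forall x y z, R' x y -> R' y z -> R' x z) ->
  clos_trans T R x y -> R' x y.
Proof. by move=> sub tr; elim=> {x y} [x y /sub //|x y z _ xy _]; apply: tr. Qed.

Section Edges.
Implicit Types (F : seq (nat * nat)) (a b c d : nat).
Local Notation edge F := (fun x y => (x, y) \in F).

Definition tc F a b := clos_trans nat (edge F) a b.

Lemma tc_edge F a b : (a, b) \in F -> tc F a b.
Proof. exact: t_step. Qed.

Lemma tc_trans F a b c : tc F a b -> tc F b c -> tc F a c.
Proof. exact: t_trans. Qed.

Lemma tc_subset F F' a b : {subset F <= F'} -> tc F a b -> tc F' a b.
Proof.
by move=> sub; apply: clos_trans_sub => [x y /sub|]; [exact: tc_edge|exact: tc_trans].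
Qed.

Lemma reach_tc F n a b : reach F n a b -> tc F a b.
Proof.
elim: n a => //= n IH a /hasP[[x y] xy /= /andP[/eqP <- /orP[/eqP <-|/IH yb]]].
  exact: tc_edge.
exact: tc_trans (tc_edge xy) yb.
Qed.

Lemma path_reach F n a p : path (edge F) a p -> p != [::] -> size p <= n ->
  reach F n a (last a p).
Proof.
elim: n a p => [|n IH] a [|b p] //= /andP[ab pp] _ sp; apply/hasP; exists (a, b) => //=.
rewrite eqxx /=; case: p pp sp => [|c p] pp sp; first by rewrite eqxx.
by rewrite (IH b (c :: p)) ?orbT.
Qed.

Lemma tc_path F a b : tc F a b -> exists2 p, path (edge F) a p & last a p = b.
Proof.
elim=> {a b} [a b ab|a b c _ [p pp <-] _ [q pq <-]]; first by exists [:: b]; rewrite //= ab.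
by exists (p ++ q); rewrite ?cat_path ?pp ?last_cat.
Qed.

Lemma size_uniq_path F a p : path (edge F) a p -> uniq p -> size p <= size F.
Proof.
move=> pp up; pose s := zip (belast a p) p.
have <- : size s = size p by rewrite size2_zip // size_belast.
apply: uniq_leq_size.
  by apply: (@map_uniq _ _ snd); rewrite -/(unzip2 s) unzip2_zip ?size_belast.
rewrite {}/s; elim: p a pp {up} => //= c p IH a /andP[ac pc] x.
by rewrite inE => /orP[/eqP -> //|]; apply: IH.
Qed.

(* Between distinct vertices only: [above F a a] also detects cycles, and misses those of
   length exceeding [size F]. *)
Lemma aboveP F a b : a != b -> reflect (tc F a b) (above F a b).
Proof.
move=> ne_ab; apply: (iffP idP) => [|/tc_path[p pp pb]]; first exact: reach_tc.
case/shortenP: pp pb => q pq /= /andP[_ uq] _ qb; rewrite -qb; apply: path_reach => //.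
  by apply: contraNneq ne_ab => q0; rewrite -qb q0.
exact: size_uniq_path pq uq.
Qed.

Definition acyclic F := forall a, ~ tc F a a.

Lemma tc_cons F x y a b : tc ((x, y) :: F) a b ->
  tc F a b \/ (a = x \/ tc F a x) /\ (b = y \/ tc F y b).
Proof.
elim=> {a b} [a b|a b c _ IHab _ IHbc].
  by rewrite inE => /orP[/eqP[-> ->]|/tc_edge]; [right; split; left|left].
case: IHab IHbc => [ab|[ax yb]] [bc|[bx yc]].
- by left; apply: tc_trans ab bc.
- right; split=> //; right; case: bx => [<-//|]; exact: tc_trans.
- right; split=> //; right; case: yb => [<-//|yb]; exact: tc_trans yb bc.
- by right.
Qed.

Lemma acyclic_cons F x y : acyclic F -> x != y -> ~ tc F y x -> acyclic ((x, y) :: F).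
Proof.
move=> acF /eqP ne_xy not_yx a /tc_cons[/acF //|[ax ya]].
case: ax => ax; case: ya => ya; subst=> //.
by apply: not_yx; apply: tc_trans ya ax.
Qed.

End Edges.

Lemma mem_allupairs C a b : ((a, b) \in allupairs C) = [&& a \in C, b \in C & a < b].
Proof.
apply/allpairsPdep/and3P => [[x [y [xC]]]|[aC bC ab]].
  by rewrite mem_filter => /andP[xy yC] [-> ->].
by exists a, b; rewrite mem_filter ab.
Qed.

Lemma upairC a b : upair (a, b) = upair (b, a).
Proof. by rewrite /upair /= minnC maxnC. Qed.

Lemma upairP a b : upair (a, b) = (a, b) \/ upair (a, b) = (b, a).
Proof. by rewrite /upair /=; case: leqP; [left|right]. Qed.

Lemma upair_idem x : upair (upair x) = upair x.
Proof. by case: x => a b; case: (upairP a b) => E; rewrite E // upairC. Qed.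

Lemma upair_lt a b : a < b -> upair (a, b) = (a, b).
Proof. by rewrite /upair /=; case: ltnP. Qed.

Lemma upair_eq a b c d : upair (a, b) = upair (c, d) -> a = c /\ b = d \/ a = d /\ b = c.
Proof. by case: (upairP a b) => ->; case: (upairP c d) => -> [-> ->]; auto. Qed.

Lemma upair_id C z : z \in allupairs C -> upair z = z.
Proof. by case: z => a b; rewrite mem_allupairs => /and3P[_ _]; apply: upair_lt. Qed.

Lemma mem_upair C a b : a != b -> (upair (a, b) \in allupairs C) = (a \in C) && (b \in C).
Proof.
case: (ltngtP a b) => // [ab|ba] _; first by rewrite upair_lt // mem_allupairs ab andbT.
by rewrite upairC upair_lt // mem_allupairs ba andbT andbC.
Qed.

Lemma mem_upair_sub C a b : upair (a, b) \in allupairs C -> a \in C /\ b \in C.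
Proof. by case: (upairP a b) => ->; rewrite mem_allupairs => /and3P[]. Qed.

Lemma upair_mem_neq C a b : upair (a, b) \in allupairs C -> a != b.
Proof.
by apply: contraTneq => ->; rewrite /upair /= minnn maxnn mem_allupairs ltnn !andbF.
Qed.

Lemma size_allupairs (C : seq nat) : uniq C -> size (allupairs C) = 'C(size C, 2).
Proof.
have sizeE (D : seq nat) : size (allupairs D) = \sum_(a <- D) count (ltn a) D.
  rewrite /allupairs size_allpairs_dep sumnE big_map.
  by apply: eq_bigr => a _; rewrite size_filter.
rewrite sizeE; elim: C => [|c C IH] /=; first by rewrite big_nil.
case/andP=> c_C /IH; rewrite big_cons /= ltnn add0n big_split /= => ->.
have -> : \sum_(a <- C) (a < c : nat) = count (fun a => a < c) C.
  by rewrite -sum1_count [RHS]big_mkcond.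
rewrite binS bin1 addnA [RHS]addnC; congr (_ + _).
rewrite -(count_predC (ltn c) C); congr (_ + _); apply: eq_in_count => a aC /=.
by rewrite -leqNgt ltn_neqAle; case: eqVneq aC c_C => // -> ->.
Qed.

(** * Preference weights and margins *)

Lemma prefers_trans v a b c : prefers v a b -> prefers v b c -> prefers v a c.
Proof. exact: ltn_trans. Qed.

Lemma prefers_neq v a b : prefers v a b -> a != b.
Proof. by apply: contraTneq => ->; rewrite /prefers ltnn. Qed.

Lemma prefersN v a b : a \in v -> b \in v -> a != b -> prefers v b a = ~~ prefers v a b.
Proof.
move=> av bv ne_ab; rewrite /prefers -leqNgt [RHS]leq_eqVlt.
by rewrite (inj_in_eq (@index_inj _ 0 v)) // eq_sym (negbTE ne_ab).
Qed.

Lemma index_map_in (T T' : eqType) (f : T -> T') (C s : seq T) a :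
  {in C &, injective f} -> {subset s <= C} -> a \in C -> index (f a) (map f s) = index a s.
Proof.
move=> inj_f; elim: s => //= x s IH sub aC; rewrite IH //; last first.
  by move=> y ys; apply: sub; rewrite inE ys orbT.
by rewrite (inj_in_eq inj_f) // sub ?mem_head.
Qed.

Definition votes_over (C : seq nat) (E : seq (nat * seq nat)) : bool :=
  all (fun x => perm_eq x.2 C) E.

Definition pref_weight (E : seq (nat * seq nat)) (a b : nat) : nat :=
  \sum_(x <- E) (if prefers x.2 a b then x.1 else 0).

Definition unanimous (W : seq nat) (v : seq nat) : seq (nat * seq nat) :=
  zip W (nseq (size W) v).

Lemma unanimous_over C W v : perm_eq v C -> votes_over C (unanimous W v).
Proof. by move=> vC; elim: W => //= w W ->; rewrite vC. Qed.

Lemma pref_weight_cat E E' a b :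
  pref_weight (E ++ E') a b = pref_weight E a b + pref_weight E' a b.
Proof. exact: big_cat. Qed.

Lemma pref_weight_unanimous W v a b :
  pref_weight (unanimous W v) a b = if prefers v a b then sumn W else 0.
Proof.
rewrite /pref_weight; elim: W => [|w W IH] /=; first by rewrite big_nil if_same.
by rewrite big_cons /= IH; case: prefers.
Qed.

Lemma wmg_pref_weight E a b : wmg E a b = ((pref_weight E a b)%:Z - (pref_weight E b a)%:Z)%R.
Proof. by rewrite /wmg sumrB /pref_weight !(big_morph Posz PoszD (erefl (Posz 0))). Qed.

Lemma wmgN E a b : wmg E b a = (- wmg E a b)%R.
Proof. by rewrite !wmg_pref_weight opprB. Qed.

Lemma wmg_cat E E' a b : wmg (E ++ E') a b = (wmg E a b + wmg E' a b)%R.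
Proof. by rewrite /wmg big_cat. Qed.

Lemma pref_weightD C E a b : votes_over C E -> a \in C -> b \in C -> a != b ->
  pref_weight E a b + pref_weight E b a = sumn (unzip1 E).
Proof.
move=> votesE aC bC ne_ab; rewrite /pref_weight -big_split sumnE big_map /=.
rewrite big_seq [RHS]big_seq; apply: eq_bigr => x xE.
have vC := perm_mem (allP votesE x xE).
by rewrite (@prefersN x.2 a b) ?vC //; case: prefers; rewrite ?addn0.
Qed.

(* The weights of [a] over [b] and of [b] over [a] have a constant sum. *)
Lemma wmg_le C E a b c d : votes_over C E ->
  a \in C -> b \in C -> a != b -> c \in C -> d \in C -> c != d ->
  (wmg E a b <= wmg E c d)%R = (pref_weight E a b <= pref_weight E c d).
Proof.
move=> votesE aC bC ne_ab cC dC ne_cd; rewrite !wmg_pref_weight.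
by have := pref_weightD votesE aC bC ne_ab; have := pref_weightD votesE cC dC ne_cd; lia.
Qed.

Lemma wmg_unanimous W Wv v a b : size Wv = size W -> prefers v a b ->
  (wmg (zip W Wv) a b <= wmg (unanimous W v) a b)%R.
Proof.
move=> sW vab; have nvba : prefers v b a = false.
  by apply/negbTE; rewrite /prefers -leqNgt ltnW.
elim: W Wv sW => [|w W IH] [|u Wv] //= [/IH]; rewrite /unanimous /= /wmg !big_cons /= => le_W.
apply: lerD le_W; rewrite vab nvba.
by case: (prefers u a b); case: (prefers u b a); lia.
Qed.

(** * The ranked pairs procedure *)

Section RankedPairsRun.
Variables (C : seq nat) (E : seq (nat * seq nat)) (ordC : seq nat) (ordP : seq (nat * nat)).
Implicit Types (F ps : seq (nat * nat)) (a b c d : nat).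
Local Notation before := (rp_before E ordP).

Definition tie_orders := [/\ uniq C, perm_eq ordC C & perm_eq (map upair ordP) (allupairs C)].

(* The edge [a -> b] is the one that ranked pairs fixes if [{a, b}] is not implied. *)
Definition directed a b : bool :=
  (0 < wmg E a b)%R || ((wmg E a b == 0) && (index a ordC < index b ordC)).

Lemma strengthC a b : rp_strength E (a, b) = rp_strength E (b, a).
Proof. by rewrite /rp_strength /= maxC. Qed.

Lemma strength_directed a b : directed a b -> rp_strength E (a, b) = wmg E a b.
Proof.
move=> ab; have : (0 <= wmg E a b)%R by case/orP: ab => [/ltW|/andP[/eqP ->]].
by rewrite /rp_strength /= (wmgN E a b) => D_ge0; apply/max_idPl; lia.
Qed.

Lemma strength_upair x : rp_strength E (upair x) = rp_strength E x.
Proof. by case: x => a b; case: (upairP a b) => ->; rewrite // strengthC. Qed.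

Lemma before_upair x y : before (upair x) (upair y) = before x y.
Proof. by rewrite /rp_before !strength_upair /rp_pairpos !upair_idem. Qed.

Lemma before_total : total before.
Proof. by move=> x y; rewrite /rp_before; case: ltgtP => //= _; apply: leq_total. Qed.

Lemma before_trans : transitive before.
Proof.
move=> y x z; rewrite /rp_before => /orP[xy|/andP[/eqP xy pxy]] /orP[yz|/andP[/eqP yz pyz]].
- by rewrite (lt_trans yz xy).
- by rewrite -yz xy.
- by rewrite xy yz.
- by rewrite xy yz eqxx (leq_trans pxy pyz) orbT.
Qed.

Hypothesis orders : tie_orders.

Lemma before_anti : {in allupairs C &, antisymmetric before}.
Proof.
have [_ _ pP] := orders; move=> x y xC yC; rewrite /rp_before.
case: ltgtP => //= _; rewrite /rp_pairpos (upair_id xC) (upair_id yC) -eqn_leq => pos_eq.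
by apply/eqP; rewrite -(inj_in_eq (@index_inj _ (0, 0) (map upair ordP))) ?(perm_mem pP).
Qed.

Lemma directedN a b : a \in C -> b \in C -> a != b -> directed b a = ~~ directed a b.
Proof.
case: orders => _ pC _ aC bC ne_ab; rewrite /directed (wmgN E a b) oppr_gt0 oppr_eq0.
by case: ltgtP => //= _; apply: prefersN; rewrite ?(perm_mem pC).
Qed.

Variant rp_step_spec F a b : seq (nat * nat) -> Prop :=
  | PairImplied of tc F a b \/ tc F b a : rp_step_spec F a b F
  | PairFixed c d of upair (c, d) = upair (a, b) & directed c d & ~ tc F c d & ~ tc F d c :
      rp_step_spec F a b ((c, d) :: F).

Lemma rp_stepP F a b : a \in C -> b \in C -> a != b ->
  rp_step_spec F a b (rp_step E ordC F (a, b)).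
Proof.
move=> aC bC ne_ab; have ne_ba : b != a by rewrite eq_sym.
have -> : rp_step E ordC F (a, b) = if above F a b || above F b a then F
    else (if directed a b then (a, b) else (b, a)) :: F.
  rewrite /rp_step /directed (wmgN E a b) oppr_gt0; case: ifP => // _.
  by case: ltgtP => //= _; case: ifP.
case: (aboveP F ne_ab) => [ab|nab] /=; first by constructor; left.
case: (aboveP F ne_ba) => [ba|nba] /=; first by constructor; right.
by case: ifP => ab; constructor; rewrite // 1?upairC // directedN // ab.
Qed.

Definition run ps := foldl (rp_step E ordC) [::] ps.

Lemma run_ind (P : seq (nat * nat) -> seq (nat * nat) -> Prop) : P [::] [::] ->
  (forall ps F a b F', {subset rcons ps (a, b) <= allupairs C} -> P ps F ->
     rp_step_spec F a b F' -> P (rcons ps (a, b)) F') ->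
  forall ps, {subset ps <= allupairs C} -> P ps (run ps).
Proof.
move=> P0 PS; elim/last_ind=> [|ps [a b] IH] //= sub; rewrite /run foldl_rcons.
have ab : (a, b) \in allupairs C by apply: sub; rewrite mem_rcons mem_head.
apply: (PS ps (run ps)) => //.
  by apply: IH => x xps; apply: sub; rewrite mem_rcons inE xps orbT.
move: ab; rewrite mem_allupairs => /and3P[aC bC lt_ab].
by apply: rp_stepP; rewrite // neq_ltn lt_ab.
Qed.

Lemma run_edge ps : {subset ps <= allupairs C} ->
  forall a b, (a, b) \in run ps -> directed a b /\ upair (a, b) \in ps.
Proof.
move: ps; apply: (run_ind (P := fun ps F =>
  forall a b, (a, b) \in F -> directed a b /\ upair (a, b) \in ps)) => //.
move=> ps F a b F' sub IH [_|c d cdE cd _ _] x y.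
  by move=> /IH[xy xyps]; rewrite mem_rcons inE xyps orbT.
rewrite inE => /orP[/eqP[-> ->]|/IH[xy xyps]]; last by rewrite mem_rcons inE xyps orbT.
by rewrite cdE (@upair_id C) ?mem_rcons ?mem_head ?sub // mem_rcons mem_head.
Qed.

Lemma run_acyclic ps : {subset ps <= allupairs C} -> acyclic (run ps).
Proof.
move: ps; apply: (run_ind (P := fun _ F => acyclic F)) => [a|ps F a b F' sub IH].
  by elim.
case=> [//|c d cdE _ _ ndc].
have : upair (c, d) \in allupairs C by rewrite cdE (@upair_id C) ?sub ?mem_rcons ?mem_head.
by move=> /upair_mem_neq ne_cd; apply: acyclic_cons.
Qed.

Lemma run_comparable ps : {subset ps <= allupairs C} ->
  forall a b, upair (a, b) \in ps -> tc (run ps) a b \/ tc (run ps) b a.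
Proof.
move: ps; apply: (run_ind (P := fun ps F =>
  forall a b, upair (a, b) \in ps -> tc F a b \/ tc F b a)) => //.
move=> ps F a b F' sub IH stepF x y.
have ab : upair (a, b) = (a, b) by apply: (@upair_id C); rewrite sub ?mem_rcons ?mem_head.
have subF : {subset F <= F'} by case: stepF => [_ z|c d _ _ _ _ z zF]; rewrite ?inE ?zF ?orbT.
rewrite mem_rcons inE -ab => /orP[/eqP xyE|/IH[xy|yx]]; first 1 last.
- by left; apply: tc_subset xy.
- by right; apply: tc_subset yx.
suff : tc F' a b \/ tc F' b a by case: (upair_eq xyE) => -[-> ->]; tauto.
case: stepF => [//|c d cdE _ _ _].
have : tc ((c, d) :: F) c d by apply: tc_edge; rewrite mem_head.
by case: (upair_eq cdE) => -[-> ->]; tauto.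
Qed.

Local Notation sorted_pairs := (rp_sorted_pairs C E ordP).
Local Notation fixed := (rp_fixed C E ordC ordP).

Lemma mem_sorted_pairs x : (x \in sorted_pairs) = (x \in allupairs C).
Proof. exact: mem_sort. Qed.

Lemma sorted_pairs_cat p q : sorted_pairs = p ++ q ->
  {subset p <= allupairs C} /\ {in p & q, forall x y, before x y}.
Proof.
move=> psE; split=> [x xp|x y xp yq]; first by rewrite -mem_sorted_pairs psE mem_cat xp.
have : pairwise before sorted_pairs.
  by rewrite -sorted_pairwise; [exact: sort_sorted before_total _|exact: before_trans].
by rewrite psE pairwise_cat => /and3P[/allrelP before_pq _ _]; apply: before_pq.
Qed.

Lemma fixed_acyclic : acyclic fixed.
Proof. by apply: run_acyclic => x; rewrite mem_sorted_pairs. Qed.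

Lemma fixed_comparable a b : a \in C -> b \in C -> a != b -> tc fixed a b \/ tc fixed b a.
Proof.
move=> aC bC ne_ab; apply: run_comparable => [x|]; first by rewrite mem_sorted_pairs.
by rewrite mem_sorted_pairs mem_upair // aC.
Qed.

Lemma tc_fixed_neq a b : tc fixed a b -> a != b.
Proof. by move=> ab; apply/eqP => abE; apply: (@fixed_acyclic a); rewrite {2}abE. Qed.

Lemma tc_fixed_asym a b : tc fixed a b -> ~ tc fixed b a.
Proof. by move=> ab ba; apply: (@fixed_acyclic a); apply: tc_trans ab ba. Qed.

Lemma run_prefix_fixed p q : sorted_pairs = p ++ q -> {subset run p <= fixed}.
Proof.
rewrite /rp_fixed => ->; rewrite foldl_cat -/(run p).
elim: q (run p) => [|[a b] q IH] F x xF //=; apply: IH; rewrite /rp_step.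
by do ?case: ifP => _; rewrite ?inE ?xF ?orbT.
Qed.

(** * Stack rankings *)

(* Zavist and Tideman: a ranking is a stack if it places [a] above [b] against the edge
   [b -> a] only when a chain of earlier edges leads from [a] down to [b]. *)
Definition stack_link (L : seq nat) (x : nat * nat) c d :=
  [&& c \in C, d \in C, prefers L c d, directed c d & before (c, d) x].

Definition stack_ranking (L : seq nat) :=
  perm_eq L C /\ forall a b, a \in C -> b \in C -> prefers L a b -> directed b a ->
    clos_trans nat (stack_link L (a, b)) a b.

Definition rp_ranking := sort (fun a b => above fixed a b || (a == b)) C.

Lemma perm_rp_ranking : perm_eq rp_ranking C.
Proof. exact/permPl/perm_sort. Qed.

Lemma prefers_rp_ranking a b : a \in C -> b \in C -> tc fixed a b -> prefers rp_ranking a b.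
Proof.
move=> aC bC ab; have ne_ab := tc_fixed_neq ab.
pose aboveq c d := above fixed c d || (c == d).
have aboveqP c d : reflect (c = d \/ tc fixed c d) (aboveq c d).
  rewrite /aboveq; case: eqVneq => [->|ne_cd]; rewrite ?orbT ?orbF; first by constructor; left.
  by apply: (iffP (aboveP _ ne_cd)) => [|[/eqP|//]]; [right|rewrite (negbTE ne_cd)].
have aboveq_trans : transitive aboveq.
  move=> d c e /aboveqP[->//|cd] /aboveqP[<-|de]; apply/aboveqP; right=> //.
  exact: tc_trans cd de.
have sorted_ranking : sorted aboveq rp_ranking.
  apply: (@sort_sorted_in _ (mem C)); last by apply/allP.
  move=> c d cC dC; case: (eqVneq c d) => [->|ne_cd]; first by rewrite /aboveq eqxx orbT.
  case: (fixed_comparable cC dC ne_cd) => cd; apply/orP; [left|right];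
    by apply/aboveqP; right.
have [aL bL] : a \in rp_ranking /\ b \in rp_ranking by rewrite !(perm_mem perm_rp_ranking).
rewrite -[prefers _ a b]negbK -prefersN //.
apply/negP => /(sorted_ltn_index aboveq_trans sorted_ranking _ _ bL aL)/aboveqP[/esym/eqP|].
  by rewrite (negbTE ne_ab).
exact: tc_fixed_asym ab.
Qed.

Lemma tc_rp_ranking a b : a \in C -> b \in C -> prefers rp_ranking a b -> tc fixed a b.
Proof.
move=> aC bC ab; have ne_ab := prefers_neq ab.
case: (fixed_comparable aC bC ne_ab) => // /(prefers_rp_ranking bC aC).
by rewrite (prefersN _ _ ne_ab) ?ab // (perm_mem perm_rp_ranking).
Qed.

(* Otherwise the pair [{a, b}] would have been fixed as [b -> a]. *)
Lemma tc_run_against a b p q : a \in C -> b \in C -> tc fixed a b -> directed b a ->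
  sorted_pairs = p ++ upair (a, b) :: q -> tc (run p) a b.
Proof.
move=> aC bC ab dba psE; have ne_ab := tc_fixed_neq ab.
have to_fixed F c d : {subset F <= fixed} -> tc F c d -> tc fixed c d by exact: tc_subset.
have sub := run_prefix_fixed psE.
have : {subset run (rcons p (upair (a, b))) <= fixed}.
  by apply: (@run_prefix_fixed _ q); rewrite cat_rcons.
rewrite /run foldl_rcons -/(run p).
have [x [y [xyE xC yC ne_xy]]] : exists x y,
    [/\ upair (a, b) = (x, y), x \in C, y \in C & x != y].
  by case: (upairP a b) => ->; [exists a, b|exists b, a; rewrite eq_sym].
rewrite xyE; case: (rp_stepP (run p) xC yC ne_xy) => [implied _|c d cdE dcd _ _ sub'].
  have : tc (run p) a b \/ tc (run p) b a.
    by move: xyE implied; case: (upairP a b) => -> [-> ->]; tauto.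
  by case=> // /(to_fixed _ _ _ sub) /(tc_fixed_asym ab).
have cd : tc fixed c d by apply: tc_edge; apply: sub'; rewrite mem_head.
have : upair (c, d) = upair (a, b) by rewrite cdE -xyE upair_idem.
case/upair_eq=> -[cE dE]; last by case: (tc_fixed_asym ab); rewrite -cE -dE.
by move: dcd; rewrite cE dE -[directed a b]negbK -directedN // dba.
Qed.

Lemma rp_ranking_stack : stack_ranking rp_ranking.
Proof.
split=> [|a b aC bC ab_pref dba]; first exact: perm_rp_ranking.
have ab := tc_rp_ranking aC bC ab_pref.
have ab_in : upair (a, b) \in sorted_pairs.
  by rewrite mem_sorted_pairs mem_upair ?aC ?tc_fixed_neq.
have [p [q psE]] : exists p q, sorted_pairs = p ++ upair (a, b) :: q.
  by case/splitPr: ab_in => p q; exists p, q.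
have [p_sub before_p] := sorted_pairs_cat psE.
apply: clos_trans_sub (tc_run_against aC bC ab dba psE) => [c d cd|]; last exact: t_trans.
have [dcd cd_p] := run_edge p_sub cd; have [cC dC] := mem_upair_sub (p_sub _ cd_p).
apply: t_step; rewrite /stack_link cC dC dcd prefers_rp_ranking //=.
  by rewrite -before_upair before_p ?mem_head.
by apply: tc_edge; apply: (run_prefix_fixed psE).
Qed.

Lemma stack_link_processed L p q c d a b :
  sorted_pairs = p ++ upair (c, d) :: q -> directed c d -> prefers L c d = false ->
  stack_link L (d, c) a b -> upair (a, b) \in p.
Proof.
move=> psE dcd ncd /and5P[aC bC ab dab before_ab].
have ne_ab := prefers_neq ab.
have abU : upair (a, b) \in allupairs C by rewrite mem_upair // aC.
have cdU : upair (c, d) \in allupairs C.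
  by rewrite -mem_sorted_pairs psE mem_cat mem_head orbT.
have ne_pairs : upair (a, b) <> upair (c, d).
  case/upair_eq=> -[aE bE]; first by rewrite aE bE ncd in ab.
  have [cC dC] := mem_upair_sub cdU; move: dab.
  by rewrite aE bE directedN ?dcd // (upair_mem_neq cdU).
have := abU; rewrite -mem_sorted_pairs psE mem_cat inE => /or3P[//|/eqP//|ab_q].
case: ne_pairs; apply: before_anti => //; apply/andP; split.
  by rewrite (upairC c) before_upair.
have psE' : sorted_pairs = rcons p (upair (c, d)) ++ q by rewrite cat_rcons.
by apply: (sorted_pairs_cat psE').2; rewrite ?mem_rcons ?mem_head.
Qed.

(* A pair first fixed against the stack would already be implied, by the chain that
   justifies the stack there. *)
Lemma stack_run L : stack_ranking L -> forall p q, sorted_pairs = p ++ q ->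
  forall c d, (c, d) \in run p -> prefers L c d.
Proof.
move=> [LC stackL]; elim/last_ind=> [|p [x y] IH] q //; rewrite cat_rcons => psE.
have {}IH := IH _ psE; have [p_sub _] := sorted_pairs_cat psE.
have within a b : tc (run p) a b -> prefers L a b.
  by apply: (clos_trans_sub (R' := prefers L)) => [u v /IH|u v w] //; apply: prefers_trans.
have xyU : (x, y) \in allupairs C by rewrite -mem_sorted_pairs psE mem_cat mem_head orbT.
have := xyU; rewrite mem_allupairs => /and3P[xC yC lt_xy].
have ne_xy : x != y by rewrite neq_ltn lt_xy.
rewrite /run foldl_rcons -/(run p).
case: (rp_stepP (run p) xC yC ne_xy) => [_|c d cdE dcd _ ndc] u v; first exact: IH.
rewrite inE => /orP[/eqP[-> ->]|]; last exact: IH.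
rewrite (upair_id xyU) in cdE; have cdU : upair (c, d) \in allupairs C by rewrite cdE.
have [cC dC] := mem_upair_sub cdU.
case cd : (prefers L c d) => //; case: ndc.
have dc : prefers L d c.
  by rewrite (@prefersN L c d) ?(perm_mem LC) ?cd // (upair_mem_neq cdU).
apply: clos_trans_sub (stackL d c dC cC dc dcd) => [a b link|]; last exact: tc_trans.
have ab_p : upair (a, b) \in p by apply: (@stack_link_processed L p q c d) link; rewrite ?cdE.
case: (run_comparable p_sub ab_p) => // /within; have /and5P[aC bC ab _ _] := link.
by rewrite (@prefersN L a b) ?(perm_mem LC) ?ab // (prefers_neq ab).
Qed.

Lemma tc_fixed_stack L a b : stack_ranking L -> tc fixed a b -> prefers L a b.
Proof.
move=> stackL; apply: (clos_trans_sub (R' := prefers L)) => [c d|c d e]; last first.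
  exact: prefers_trans.
by apply: (stack_run stackL (q := [::])); rewrite cats0.
Qed.

Lemma tc_stack_fixed L a b : stack_ranking L -> a \in C -> b \in C -> prefers L a b ->
  tc fixed a b.
Proof.
move=> stackL aC bC ab; have ne_ab := prefers_neq ab.
case: (fixed_comparable aC bC ne_ab) => // /(tc_fixed_stack stackL).
by rewrite (prefersN _ _ ne_ab) ?ab // (perm_mem stackL.1).
Qed.

Lemma rp_winners_stack L : stack_ranking L -> rp_winners C E ordC ordP = take 1 L.
Proof.
move=> stackL; have [uC _ _] := orders; have LC := perm_mem stackL.1.
case LE : L => [|w L'].
  by rewrite /rp_winners; have := perm_size stackL.1; rewrite LE; case: (C).
have wC : w \in C by rewrite -LC LE mem_head.
rewrite /= take0 -(filter_pred1_uniq uC wC); apply: eq_in_filter => c cC /=.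
have w_top d : prefers L d w = false by rewrite /prefers LE /= eqxx.
case: (eqVneq c w) => [->|ne_cw].
  apply/hasPn=> d dC; apply/negP=> /reach_tc.
  by move/(tc_fixed_stack stackL); rewrite w_top.
apply/negbTE/negPn/hasP; exists w => //; apply/aboveP; first by rewrite eq_sym.
by apply: tc_stack_fixed stackL _ _ _ => //; rewrite (prefersN _ _ ne_cw) ?LC ?w_top.
Qed.

End RankedPairsRun.

Lemma directed_mono E E' ordC a b : (wmg E a b <= wmg E' a b)%R ->
  directed E ordC a b -> directed E' ordC a b.
Proof. by rewrite /directed; lia. Qed.

(* Raising the margins in the direction of a stack only strengthens its chains. *)
Lemma stack_ranking_mono C E E' ordC ordP L :
  (forall a b, a \in C -> b \in C -> prefers L a b -> (wmg E a b <= wmg E' a b)%R) ->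
  stack_ranking C E ordC ordP L -> stack_ranking C E' ordC ordP L.
Proof.
move=> le_EE' [LC stackL]; split=> // a b aC bC ab dba'.
have le_ba : (wmg E' b a <= wmg E b a)%R by rewrite (wmgN E' a b) (wmgN E a b) lerN2 le_EE'.
have dba := directed_mono le_ba dba'.
apply: clos_trans_sub (stackL a b aC bC ab dba) => [c d|]; last exact: t_trans.
case/and5P=> cC dC cd dcd before_cd; have le_cd := le_EE' c d cC dC cd.
apply: t_step; rewrite /stack_link cC dC cd (directed_mono le_cd dcd) /=.
have le_ab_str : (rp_strength E' (a, b) <= rp_strength E (a, b))%R.
  by rewrite strengthC (strengthC E) !(@strength_directed _ ordC) // le_ba.
have le_cd_str : (rp_strength E (c, d) <= rp_strength E' (c, d))%R.
  by rewrite !(@strength_directed _ ordC) // (directed_mono le_cd dcd).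
by move: before_cd; rewrite /rp_before; lia.
Qed.

Lemma stack_ranking_map (f : nat -> nat) C C' E E' ordC ordC' ordP ordP' L :
  {in C &, injective f} -> C' = map f C ->
  (forall a b, a \in C -> b \in C -> a != b ->
     directed E' ordC' (f a) (f b) = directed E ordC a b) ->
  (forall a b c d, a \in C -> b \in C -> a != b -> c \in C -> d \in C -> c != d ->
     rp_before E' ordP' (f a, f b) (f c, f d) = rp_before E ordP (a, b) (c, d)) ->
  stack_ranking C E ordC ordP L -> stack_ranking C' E' ordC' ordP' (map f L).
Proof.
move=> inj_f -> directed_f before_f [LC stackL]; split=> [|a' b']; first exact: perm_map.
have L_sub : {subset L <= C} by move=> c; rewrite (perm_mem LC).
have prefers_f a b : a \in C -> b \in C -> prefers (map f L) (f a) (f b) = prefers L a b.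
  by move=> aC bC; rewrite /prefers !(index_map_in inj_f L_sub).
case/mapP=> a aC ->{a'} /mapP[b bC ->{b'}]; rewrite prefers_f // => ab.
have ne_ab := prefers_neq ab; rewrite directed_f 1?eq_sym // => dba.
pose link' := stack_link (map f C) E' ordC' ordP' (map f L) (f a, f b).
apply: (clos_trans_sub (R' := fun c d => clos_trans nat link' (f c) (f d)) _ _
  (stackL a b aC bC ab dba)).
  move=> c d /and5P[cC dC cd dcd before_cd]; have ne_cd := prefers_neq cd.
  apply: t_step; rewrite /link' /stack_link !map_f // prefers_f // cd directed_f // dcd.
  by rewrite before_f.
by move=> c d e; apply: t_trans.
Qed.

(* Voting for the outcome instead raises the margins in its direction. *)
Lemma rp_ranking_unanimous C V W Wv ordC ordP : tie_orders C ordC ordP -> size Wv = size W ->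
  let L := rp_ranking C (V ++ zip W Wv) ordC ordP in
  stack_ranking C (V ++ unanimous W L) ordC ordP L.
Proof.
move=> orders sW L; apply: stack_ranking_mono (rp_ranking_stack _ orders) => a b _ _ ab.
by rewrite !wmg_cat lerD2l; apply: wmg_unanimous.
Qed.

(** * Turing machine runs *)

Section TuringMachineRuns.
Variable M : TM.
Local Notation step := (@tm_step M).

Lemma tm_step_halted (c : cfg M) : tm_halt M (tm_state_of c) -> step c = c.
Proof. by case: c => [[[q l] h] r] /= ->. Qed.

Lemma iter_tm_step_halted t t' (c : cfg M) :
  tm_halt M (tm_state_of (iter t step c)) -> t <= t' -> iter t' step c = iter t step c.
Proof.
move=> halted le_tt'; rewrite -(subnK le_tt') iterD.
by elim: (t' - t) => //= n ->; apply: tm_step_halted.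
Qed.

End TuringMachineRuns.

(** * Stack machines on a single tape *)

Lemma onth_rev_cons_size T (a : T) v : onth (rev (a :: v)) (size v) = Some a.
Proof. by rewrite rev_cons -cats1 onth_cat size_rev ltnn subnn. Qed.

Lemma onth_rev_cons_neq T (a : T) v p : p != size v -> onth (rev (a :: v)) p = onth (rev v) p.
Proof.
move=> ne_p; rewrite rev_cons -cats1 onth_cat size_rev; case: ltnP => // le_vp.
by rewrite [RHS]onth_default ?size_rev // onth_default // subn_gt0 ltn_neqAle eq_sym ne_p.
Qed.

Definition upd (I : finType) T (f : {ffun I -> T}) i v : {ffun I -> T} :=
  [ffun k => if k == i then v else f k].

Lemma updE (I : finType) T (f : {ffun I -> T}) i v k :
  upd f i v k = if k == i then v else f k.
Proof. exact: ffunE. Qed.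

Lemma upd_eq (I : finType) T (f : {ffun I -> T}) i v : upd f i v i = v.
Proof. by rewrite updE eqxx. Qed.

Lemma upd_neq (I : finType) T (f : {ffun I -> T}) i v k : k != i -> upd f i v k = f k.
Proof. by rewrite updE => /negbTE ->. Qed.

Definition store (I G : finType) := {ffun I -> seq G}.

Inductive instr (I G : finType) (X : Type) :=
  | PushTo of I & G & X
  | PopFrom of I & (option G -> X)
  | Goto of X.
Arguments Goto {I G X}.

Definition run_instr (I G : finType) X (c : instr I G X) (s : store I G) : X * store I G :=
  match c with
  | PushTo i a x => (x, upd s i (a :: s i))
  | PopFrom i f => if s i is a :: v then (f (Some a), upd s i v) else (f None, s)
  | Goto x => (x, s)
  end.

Section StackMachine.
Variables (I G Q : finType) (code : Q -> instr I G (Q + bool)).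
Local Notation store := (store I G).

(* A label [inl q] is a state of the flowchart, [inr b] a halt with answer [b]. *)
Fixpoint run_flowchart (t : nat) (x : Q + bool) (s : store) : (Q + bool) * store :=
  match t, x with
  | t'.+1, inl q => let: (x', s') := run_instr (code q) s in run_flowchart t' x' s'
  | _, _ => (x, s)
  end.

Variables (start : Q + bool) (input : I) (emb : letter -> G).

(* The mark [Some None] singles out the leftmost cell, where all stacks have
   their bottoms; [Some (Some b)] is the output mark. *)
Definition track_sym : finType := (option (option bool) * {ffun I -> option G})%type.
Definition head_state : finType := (bool + (Q + Q + (Q + bool)))%type.
Definition Initial : head_state := inl false.
Definition Halted : head_state := inl true.
Definition Seeking q : head_state := inr (inl (inl q)).
Definition Taking q : head_state := inr (inl (inr q)).
Definition Returning x : head_state := inr (inr x).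

Definition stack_delta (st : head_state) (y : track_sym) : head_state * track_sym * move :=
  match st with
  | inl false => (Returning start, (Some None, y.2), MStay)
  | inl true => (st, y, MStay)
  | inr (inl (inl q)) =>
      match code q with
      | Goto x => (Returning x, y, MStay)
      | PushTo i a x => if y.2 i is Some _ then (st, y, MRight)
                        else (Returning x, (y.1, upd y.2 i (Some a)), MStay)
      | PopFrom i f => if y.2 i is Some _ then (st, y, MRight)
                       else if y.1 is Some None then (Returning (f None), y, MStay)
                       else (Taking q, y, MLeft)
      end
  | inr (inl (inr q)) =>
      match code q with
      | PopFrom i f => (Returning (f (y.2 i)), (y.1, upd y.2 i None), MStay)
      | _ => (st, y, MStay)
      end
  | inr (inr x) =>
      if y.1 is Some None then
        match x with
        | inl q => (Seeking q, y, MStay)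
        | inr b => (Halted, (Some (Some b), y.2), MStay)
        end
      else (st, y, MLeft)
  end.

Definition stack_TM : TM := {|
  tm_state := head_state; tm_sym := track_sym; tm_start := Initial;
  tm_halt := fun st => st == Halted;
  tm_blank := (None, [ffun => None]);
  tm_in := fun a => (None, [ffun i => if i == input then Some (emb a) else None]);
  tm_out := fun y => if y.1 is Some (Some b) then Some (if b then l1 else l0) else None;
  tm_delta := stack_delta |}.

Definition cell (s : store) (p : nat) : track_sym :=
  (if p == 0 then Some None else None, [ffun i => onth (rev (s i)) p]).

Lemma stack_delta_push q i a x y : code q = PushTo i a x ->
  stack_delta (Seeking q) y =
  if y.2 i is Some _ then (Seeking q, y, MRight)
  else (Returning x, (y.1, upd y.2 i (Some a)), MStay).
Proof. by move=> /= ->. Qed.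

Lemma stack_delta_pop q i f y : code q = PopFrom i f ->
  stack_delta (Seeking q) y =
  if y.2 i is Some _ then (Seeking q, y, MRight)
  else if y.1 is Some None then (Returning (f None), y, MStay) else (Taking q, y, MLeft).
Proof. by move=> /= ->. Qed.

Lemma stack_delta_take q i f y : code q = PopFrom i f ->
  stack_delta (Taking q) y = (Returning (f (y.2 i)), (y.1, upd y.2 i None), MStay).
Proof. by move=> /= ->. Qed.

(* The first [m] cells, with the head on cell [p]. *)
Definition tape (s : store) (m p : nat) (st : head_state) : cfg stack_TM :=
  (st, rev (map (cell s) (iota 0 p)), cell s p, map (cell s) (iota p.+1 (m - p.+1))).

Definition fits (s : store) m := forall i, size (s i) <= m.

Local Notation step := (@tm_step stack_TM).
Implicit Type s : store.

Lemma fitsW s m m' : fits s m -> m <= m' -> fits s m'.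
Proof. by move=> fs le_mm' i; apply: leq_trans (fs i) le_mm'. Qed.

Lemma fits_upd s m i v : fits s m -> size v <= m -> fits (upd s i v) m.
Proof. by move=> fs sv k; rewrite updE; case: eqP. Qed.

Lemma cell_free s p i : size (s i) <= p -> (cell s p).2 i = None.
Proof. by move=> le_sp; rewrite ffunE onth_default ?size_rev. Qed.

Lemma cell_used s p i : p < size (s i) -> (cell s p).2 i.
Proof. by rewrite ffunE onthTE size_rev. Qed.

Lemma cell_top s i a v : s i = a :: v -> (cell s (size v)).2 i = Some a.
Proof. by move=> E; rewrite ffunE E onth_rev_cons_size. Qed.

Lemma cell_blank s m p : fits s m -> 0 < m -> m <= p -> cell s p = tm_blank stack_TM.
Proof.
move=> fs m_gt0 le_mp; rewrite /cell -[p == 0]negbK -lt0n (leq_trans m_gt0 le_mp) /=.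
by congr (_, _); apply/ffunP=> i; rewrite !ffunE onth_default // size_rev (leq_trans (fs i)).
Qed.

Lemma cell_upd s i v p :
  cell (upd s i v) p = ((cell s p).1, upd (cell s p).2 i (onth (rev v) p)).
Proof. by congr (_, _); apply/ffunP=> k; rewrite updE !ffunE; case: eqP. Qed.

Lemma cell_upd_same s i v p :
  onth (rev v) p = onth (rev (s i)) p -> cell (upd s i v) p = cell s p.
Proof.
move=> E; rewrite cell_upd E [RHS]surjective_pairing; congr (_, _).
by apply/ffunP=> k; rewrite updE ffunE; case: eqP => // ->.
Qed.

Lemma rev_cells_succ s p :
  rev (map (cell s) (iota 0 p.+1)) = cell s p :: rev (map (cell s) (iota 0 p)).
Proof. by rewrite -addn1 iotaD map_cat rev_cat. Qed.

Lemma step_right s m p st st' : fits s m -> p < m -> st != Halted ->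
  stack_delta st (cell s p) = (st', cell s p, MRight) ->
  step (tape s m p st) = tape s (maxn m p.+2) p.+1 st'.
Proof.
move=> fs lt_pm running dE.
rewrite /tm_step /tape [tm_halt _ _](negbTE running) [tm_delta _ _ _]dE rev_cells_succ.
case: (leqP m p.+1) => [le_mp|lt_pm1].
  have -> : m - p.+1 = 0 by lia.
  have -> : maxn m p.+2 - p.+2 = 0 by lia.
  by rewrite /= (@cell_blank s m p.+1) //; lia.
by have [-> ->] : m - p.+1 = (m - p.+2).+1 /\ maxn m p.+2 = m by lia.
Qed.

Lemma step_left s m p st st' : p.+1 < m -> st != Halted ->
  stack_delta st (cell s p.+1) = (st', cell s p.+1, MLeft) ->
  step (tape s m p.+1 st) = tape s m p st'.
Proof.
move=> lt_pm running dE.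
rewrite /tm_step /tape [tm_halt _ _](negbTE running) [tm_delta _ _ _]dE rev_cells_succ.
by have -> : m - p.+1 = (m - p.+2).+1 by lia.
Qed.

Lemma step_write s s' m p st st' : st != Halted -> p < m ->
  (forall k, k != p -> cell s' k = cell s k) ->
  stack_delta st (cell s p) = (st', cell s' p, MStay) ->
  step (tape s m p st) = tape s' m p st'.
Proof.
move=> running lt_pm same dE.
rewrite /tm_step /tape [tm_halt _ _](negbTE running) [tm_delta _ _ _]dE.
congr (_, rev _, _, _); apply/eq_in_map=> k; rewrite mem_iota => k_range.
  by rewrite same //; lia.
by rewrite same //; lia.
Qed.

Lemma step_stay s m p st st' : st != Halted -> p < m ->
  stack_delta st (cell s p) = (st', cell s p, MStay) ->
  step (tape s m p st) = tape s m p st'.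
Proof. by move=> running lt_pm; apply: step_write. Qed.

Lemma return_home s m p x : p < m ->
  iter p step (tape s m p (Returning x)) = tape s m 0 (Returning x).
Proof.
elim: p => // p IH lt_pm; rewrite iterSr (step_left (st' := Returning x)) //.
by apply: IH; apply: ltnW.
Qed.

Definition seeks q i := forall y : track_sym, y.2 i ->
  stack_delta (Seeking q) y = (Seeking q, y, MRight).

Lemma seek_top s m i q : seeks q i -> fits s m -> 0 < m ->
  iter (size (s i)) step (tape s m 0 (Seeking q)) =
  tape s (maxn m (size (s i)).+1) (size (s i)) (Seeking q).
Proof.
move=> seek fs m_gt0.
suff climb p : p <= size (s i) ->
    iter p step (tape s m 0 (Seeking q)) = tape s (maxn m p.+1) p (Seeking q).
  exact: climb.
elim: p => [_|p IH lt_ps]; first by rewrite (maxn_idPl m_gt0).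
rewrite iterS IH ?(ltnW lt_ps) // (step_right (st' := Seeking q)) //.
- by congr (tape _ _ _ _); lia.
- exact: fitsW fs (leq_maxl _ _).
- exact: leq_maxr.
- exact/seek/cell_used.
Qed.

(* Simulating one instruction costs a sweep over the tape, which may grow by one cell. *)
Definition simulates_instr (s : store) m q (x : Q + bool) s' :=
  exists n m', [/\ n <= m.*2 + 4, fits s' m', m' <= m.+1, 0 < m' &
    iter n step (tape s m 0 (Seeking q)) = tape s' m' 0 (Returning x)].

Lemma simulate_goto s m q x : fits s m -> 0 < m -> code q = Goto x ->
  simulates_instr s m q x s.
Proof.
move=> fs m_gt0 qE; exists 1, m; split; rewrite ?leqnSn ?addnS //.
by apply: step_stay; rewrite //= qE.
Qed.

Lemma simulate_push s m q i a x : fits s m -> 0 < m -> code q = PushTo i a x ->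
  simulates_instr s m q x (upd s i (a :: s i)).
Proof.
move=> fs m_gt0 qE; have le_sm := fs i.
exists (size (s i) + (size (s i)).+1), (maxn m (size (s i)).+1).
split; [by lia| |by lia|by lia|].
  by apply: fits_upd; [apply: fitsW fs _; lia|rewrite /=; lia].
have seek : seeks q i by move=> y; rewrite (stack_delta_push _ qE); case: (y.2 i).
rewrite iterD iterS (seek_top seek fs m_gt0).
rewrite (@step_write _ (upd s i (a :: s i)) _ _ _ (Returning x)).
- by apply: return_home; lia.
- by [].
- by lia.
- by move=> k ne_k; rewrite cell_upd_same // onth_rev_cons_neq.
- by rewrite (stack_delta_push _ qE) cell_free // cell_upd onth_rev_cons_size.
Qed.

Lemma simulate_pop_empty s m q i f :
  fits s m -> 0 < m -> code q = PopFrom i f -> s i = [::] ->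
  simulates_instr s m q (f None) s.
Proof.
move=> fs m_gt0 qE sE; exists 1, m; split; rewrite ?leqnSn ?addnS //.
by apply: step_stay; rewrite // (stack_delta_pop _ qE) cell_free // sE.
Qed.

Lemma simulate_pop s m q i f a v :
  fits s m -> 0 < m -> code q = PopFrom i f -> s i = a :: v ->
  simulates_instr s m q (f (Some a)) (upd s i v).
Proof.
move=> fs m_gt0 qE sE; have top : size (s i) = (size v).+1 by rewrite sE.
have lt_vm : size v < m by rewrite -top.
exists (size v + (size (s i)).+2), (maxn m (size (s i)).+1).
split; [by lia| |by lia|by lia|].
  by apply: fits_upd; [apply: fitsW fs _; lia|lia].
have seek : seeks q i by move=> y; rewrite (stack_delta_pop _ qE); case: (y.2 i).
rewrite iterD !iterS (seek_top seek fs m_gt0) top.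
rewrite (step_left (st' := Taking q)); first last.
- by rewrite (stack_delta_pop _ qE) cell_free ?top.
- by [].
- by lia.
rewrite (@step_write _ (upd s i v) _ _ _ (Returning (f (Some a)))).
- by apply: return_home; lia.
- by [].
- by lia.
- by move=> k ne_k; rewrite cell_upd_same // sE onth_rev_cons_neq.
- by rewrite (stack_delta_take _ qE) (cell_top sE) cell_upd onth_default ?size_rev.
Qed.

Lemma simulate_instr s m q x s' : fits s m -> 0 < m ->
  run_instr (code q) s = (x, s') -> simulates_instr s m q x s'.
Proof.
move=> fs m_gt0; case qE: (code q) => [i a y|i f|y] /=.
- by case=> <- <-; apply: simulate_push qE.
- case sE: (s i) => [|a v] [<- <-]; first exact: simulate_pop_empty qE sE.
  exact: simulate_pop qE sE.
- by case=> <- <-; apply: simulate_goto qE.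
Qed.

Lemma simulate_flowchart t x s m b s' : run_flowchart t x s = (inr b, s') ->
  fits s m -> 0 < m ->
  exists n m', [/\ n <= t * ((m + t).*2 + 5), 0 < m' &
    iter n step (tape s m 0 (Returning x)) = tape s' m' 0 (Returning (inr b))].
Proof.
elim: t x s m => [|t IH] x s m /=.
  by case=> -> -> _ m_gt0; exists 0, m.
case: x => [q|c]; last by case=> -> -> _ m_gt0; exists 0, m.
case E: (run_instr (code q) s) => [x1 s1] run fs m_gt0.
have [n [m1 [le_n fs1 le_m1 m1_gt0 sim1]]] := simulate_instr fs m_gt0 E.
have [n' [m' [le_n' m'_gt0 sim']]] := IH _ _ _ run fs1 m1_gt0.
exists (n' + n.+1), m'; split=> //.
  have : n' <= t * ((m + t.+1).*2 + 5) by apply: leq_trans le_n' _; rewrite leq_mul2l; lia.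
  by rewrite mulSn; lia.
by rewrite iterD iterSr (step_stay (st' := Seeking q)) // sim1.
Qed.

(* The input is written from left to right, so its last letter is on top. *)
Definition input_store (x : seq letter) : store :=
  [ffun i => if i == input then rev (map emb x) else [::]].

Lemma cell_input x p : p < size x ->
  cell (input_store x) p =
  (if p == 0 then Some None else None, (tm_in stack_TM (nth l0 x p)).2).
Proof.
move=> lt_px; congr (_, _); apply/ffunP=> i; rewrite !ffunE.
case: eqP => _; last by rewrite onth_default.
by rewrite revK onthE (nth_map (emb l0)) ?(nth_map l0) // size_map.
Qed.

Lemma init_tape (x : seq letter) :
  step (tm_init stack_TM x) = tape (input_store x) (maxn 1 (size x)) 0 (Returning start).
Proof.
case: x => [|a x]; rewrite /tm_init /tape /=.
  by congr (_, _, _, _); congr (_, _); apply/ffunP=> i; rewrite !ffunE; case: eqP.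
have -> : maxn 1 (size x).+1 - 1 = size x by lia.
congr (_, _, _, _); first by rewrite cell_input.
apply: (@eq_from_nth _ (tm_blank stack_TM)) => [|k]; rewrite !size_map ?size_iota // => lt_kx.
by rewrite (nth_map l0) // (nth_map 0) ?size_iota // nth_iota // add1n cell_input.
Qed.

Lemma stack_TM_runs t x b s' : run_flowchart t start (input_store x) = (inr b, s') ->
  forall T, t * ((size x + t).*2 + 7) + 2 <= T -> runs_to stack_TM x (enc_bool b) T.
Proof.
move=> run T le_T.
have fs : fits (input_store x) (maxn 1 (size x)).
  by move=> i; rewrite ffunE; case: eqP => // _; rewrite size_rev size_map; lia.
have [n [m' [le_n m'_gt0 sim]]] := simulate_flowchart run fs (leq_maxl _ _).
have le_nT : n.+2 <= T.
  apply: leq_trans le_T; rewrite -addn2 leq_add2r; apply: leq_trans le_n _.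
  by rewrite leq_mul2l; lia.
have halt : iter n.+2 step (tm_init stack_TM x) =
    (Halted, [::], (Some (Some b), (cell s' 0).2), map (cell s') (iota 1 (m' - 1))).
  by rewrite iterS iterSr init_tape sim /=; case: (cell s' 0).
rewrite /runs_to (iter_tm_step_halted _ le_nT) halt //=; split=> //; congr (_ :: _).
by case: (m' - 1).
Qed.

End StackMachine.

(** * Polynomially bounded functions *)

Definition poly_growth (f : nat -> nat) :=
  {homo f : m n / m <= n} /\ exists c k, forall n, f n <= c * n.+1 ^ k.

Lemma leq_monomial c k c' k' n : c <= c' -> k <= k' -> c * n.+1 ^ k <= c' * n.+1 ^ k'.
Proof. by move=> le_c le_k; apply: leq_mul => //; apply: leq_pexp2l. Qed.

Lemma poly_growth_const c : poly_growth (fun=> c).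
Proof. by split=> //; exists c, 0 => n; rewrite muln1. Qed.

Lemma poly_growth_id : poly_growth id.
Proof. by split=> //; exists 1, 1 => n; rewrite mul1n. Qed.

Lemma poly_growthD f g : poly_growth f -> poly_growth g -> poly_growth (fun n => f n + g n).
Proof.
move=> [mf [c [k le_f]]] [mg [c' [k' le_g]]]; split.
  by move=> m n le_mn; rewrite leq_add ?mf ?mg.
exists (c + c'), (maxn k k') => n; rewrite mulnDl leq_add //.
  by apply: leq_trans (le_f n) _; apply: leq_monomial => //; apply: leq_maxl.
by apply: leq_trans (le_g n) _; apply: leq_monomial => //; apply: leq_maxr.
Qed.

Lemma poly_growth_double f : poly_growth f -> poly_growth (fun n => (f n).*2).
Proof.
move=> pf; have [m [c [k le_f]]] := poly_growthD pf pf.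
by split=> [a b /m|]; [rewrite !addnn|exists c, k => n; rewrite -addnn].
Qed.

Lemma poly_growthM f g : poly_growth f -> poly_growth g -> poly_growth (fun n => f n * g n).
Proof.
move=> [mf [c [k le_f]]] [mg [c' [k' le_g]]]; split.
  by move=> m n le_mn; rewrite leq_mul ?mf ?mg.
by exists (c * c'), (k + k') => n; rewrite expnD mulnACA leq_mul.
Qed.

Lemma poly_growthX f k : poly_growth f -> poly_growth (fun n => f n ^ k).
Proof.
move=> pf; elim: k => [|k IH]; first exact: poly_growth_const.
have [m le_m] := poly_growthM pf IH.
split=> [a b /m|]; first by rewrite !expnS.
by case: le_m => c [d le_cd]; exists c, d => n; rewrite expnS.
Qed.

Lemma poly_growth_comp f g : poly_growth f -> poly_growth g -> poly_growth (fun n => f (g n)).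
Proof.
move=> [mf [c [k le_f]]] [mg [c' [k' le_g]]]; split.
  by move=> m n le_mn; apply/mf/mg.
exists (c * c'.+1 ^ k), (k' * k) => n; apply: leq_trans (le_f _) _.
rewrite -mulnA leq_mul2l expnM -expnMn; apply/orP; right.
case: k {le_f} => // k; rewrite leq_exp2r //.
have : 0 < n.+1 ^ k' by rewrite expn_gt0.
by move: (le_g n); rewrite mulSn; lia.
Qed.

Lemma poly_growth_sum (R : finType) (f : R -> nat -> nat) :
  (forall r, poly_growth (f r)) -> poly_growth (fun n => \sum_r f r n).
Proof.
move=> pf; suff ps s : poly_growth (fun n => \sum_(r <- s) f r n) by apply: ps.
elim: s => [|r s [m [c [k le_ck]]]].
  by split=> [m n _|]; [rewrite !big_nil|exists 0, 0 => n; rewrite big_nil].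
have [m' [c' [k' le_ck']]] := poly_growthD (pf r) (conj m (ex_intro _ c (ex_intro _ k le_ck))).
split=> [a b /m'|]; first by rewrite !big_cons.
by exists c', k' => n; rewrite big_cons.
Qed.

Lemma poly_growth_affine_monomial f : poly_growth f ->
  exists c k, forall n, f n <= c * n ^ k + c.
Proof.
case=> _ [c [k le_f]]; exists (c * 2 ^ k), k => n; apply: leq_trans (le_f n) _.
rewrite -{2}[c * 2 ^ k]muln1 -mulnDr -mulnA leq_mul2l; apply/orP; right.
case: (posnP n) => [->|n_gt0]; first by rewrite exp1n muln_gt0 expn_gt0 addn1.
apply: leq_trans (_ : (2 * n) ^ k <= _).
  by case: k {le_f} => // k; rewrite leq_exp2r //; lia.
by rewrite expnMn leq_mul2l leq_addr orbT.
Qed.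

(** * Structured stack programs *)

Inductive stack_prog (I G : finType) : finType -> Type :=
  | Ret (R : finType) (r : R) : stack_prog I G R
  | Push (i : I) (a : G) : stack_prog I G unit
  | Pop (i : I) : stack_prog I G (option G)
  | Bind (R1 R2 : finType) (p : stack_prog I G R1) (f : R1 -> stack_prog I G R2) :
      stack_prog I G R2
  | Iter (S R : finType) (f : S -> stack_prog I G (S + R)%type) (s : S) : stack_prog I G R.
Arguments Ret {I G R}.
Arguments Push {I G}.
Arguments Pop {I G}.

Notation "'let*' r := p 'in' q" := (Bind p (fun r => q))
  (at level 200, r name, p at level 100, q at level 200,
   format "'[v' 'let*'  r  :=  p  'in' '/' q ']'").

Definition continue (I G S R : finType) (x : S) : stack_prog I G (S + R)%type :=
  Ret (inl x : (S + R)%type).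
Definition break (I G S R : finType) (r : R) : stack_prog I G (S + R)%type :=
  Ret (inr r : (S + R)%type).
Arguments continue {I G S R}.
Arguments break {I G S R}.

Section Programs.
Variables (I G : finType).
Local Notation store := (store I G).
Local Notation prog := (stack_prog I G).
Implicit Type s : store.

Inductive exec : forall R : finType, prog R -> store -> nat -> R -> store -> Prop :=
  | ExecRet R r s : exec (@Ret I G R r) s 0 r s
  | ExecPush i a s : exec (Push i a) s 1 tt (upd s i (a :: s i))
  | ExecPopEmpty i s : s i = [::] -> exec (Pop i) s 1 None s
  | ExecPop i a v s : s i = a :: v -> exec (Pop i) s 1 (Some a) (upd s i v)
  | ExecBind R1 R2 (p : prog R1) (f : R1 -> prog R2) s t r s1 t' r' s2 :
      exec p s t r s1 -> exec (f r) s1 t' r' s2 -> exec (Bind p f) s (t + t') r' s2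
  | ExecBreak (S R : finType) (f : S -> prog (S + R)%type) x s t r s' :
      exec (f x) s t (inr r) s' -> exec (Iter f x) s t.+1 r s'
  | ExecContinue (S R : finType) (f : S -> prog (S + R)%type) x y s t s1 t' r s' :
      exec (f x) s t (inl y) s1 -> exec (Iter f y) s1 t' r s' ->
      exec (Iter f x) s (t + t').+1 r s'.

Definition store_size s := \sum_i size (s i).

Lemma store_size_upd s i v : store_size (upd s i v) + size (s i) = store_size s + size v.
Proof.
rewrite /store_size (bigD1 i) //= [in RHS](bigD1 i) //= upd_eq.
rewrite (eq_bigr (fun k => size (s k))) => [|k ne_k]; last by rewrite upd_neq.
by rewrite addnC addnA [RHS]addnAC.
Qed.

Lemma leq_store_size s i : size (s i) <= store_size s.
Proof. by rewrite /store_size (bigD1 i) //= leq_addr. Qed.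

Lemma exec_store_size (R : finType) (p : prog R) s t r s' :
  exec p s t r s' -> store_size s' <= store_size s + t.
Proof.
elim=> {R p s t r s'}.
- by move=> *; rewrite addn0.
- by move=> i a s; have /= := store_size_upd s i (a :: s i); lia.
- by move=> i s _; apply: leq_addr.
- by move=> i a v s sE; have := store_size_upd s i v; rewrite sE /=; lia.
- by move=> R1 R2 p f s t r s1 t' r' s2 _ IHp _ IHf; lia.
- by move=> S R f x s t r s' _ IH; lia.
- by move=> S R f x y s t s1 t' r s' _ IHf _ IHi; lia.
Qed.

Fixpoint states (R : finType) (p : prog R) : finType :=
  match p with
  | Ret _ _ => void
  | Push _ _ => unit
  | Pop _ => unit
  | Bind R1 _ p f => (states p + {r : R1 & states (f r)})%type
  | Iter A _ f _ => (A + {x : A & states (f x)})%type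
  end.

(* [k] is the label reached with each result, [inj] embeds the states of [p]. *)
Fixpoint entry X (R : finType) (p : prog R) : (R -> X) -> (states p -> X) -> X :=
  match p in stack_prog _ _ R return (R -> X) -> (states p -> X) -> X with
  | Ret _ r => fun k _ => k r
  | Push _ _ => fun _ inj => inj tt
  | Pop _ => fun _ inj => inj tt
  | Bind R1 R2 p f => fun k inj =>
      entry (p := p) (fun r => entry (p := f r) k (fun z => inj (inr (existT _ r z))))
        (fun z => inj (inl z))
  | Iter A R f x => fun _ inj => inj (inl x)
  end.

Definition loop_exit X (S R : finType) (k : R -> X) (back : S -> X) (v : (S + R)%type) : X :=
  match v with inl x => back x | inr r => k r end.

Fixpoint code_of X (R : finType) (p : prog R) :
    (R -> X) -> (states p -> X) -> states p -> instr I G X :=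
  match p in stack_prog _ _ R
  return (R -> X) -> (states p -> X) -> states p -> instr I G X with
  | Ret _ _ => fun _ _ z => match z with end
  | Push i a => fun k _ _ => PushTo i a (k tt)
  | Pop i => fun k _ _ => PopFrom i k
  | Bind R1 R2 p f => fun k inj z =>
      match z with
      | inl z => code_of (p := p)
          (fun r => entry (p := f r) k (fun z => inj (inr (existT _ r z))))
          (fun z => inj (inl z)) z
      | inr (existT r z) => code_of (p := f r) k (fun z => inj (inr (existT _ r z))) z
      end
  | Iter A R f _ => fun k inj z =>
      match z with
      | inl x => Goto (entry (p := f x) (loop_exit k (fun y => inj (inl y)))
                   (fun z => inj (inr (existT _ x z))))
      | inr (existT x z) => code_of (p := f x) (loop_exit k (fun y => inj (inl y)))
                   (fun z => inj (inr (existT _ x z))) z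
      end
  end.

Lemma exec_run_flowchart (Q : finType) (code : Q -> instr I G (Q + bool)) (R : finType)
    (p : prog R) s t r s' :
  exec p s t r s' -> forall (k : R -> Q + bool) (inj : states p -> Q),
  (forall z, code (inj z) = code_of k (fun z => inl (inj z)) z) ->
  forall n, run_flowchart code (t + n) (entry k (fun z => inl (inj z))) s =
            run_flowchart code n (k r) s'.
Proof.
elim=> {R p s t r s'}.
- by [].
- by move=> i a s k inj codeE n; rewrite add1n /= codeE.
- by move=> i s sE k inj codeE n; rewrite add1n /= codeE /= sE.
- by move=> i a v s sE k inj codeE n; rewrite add1n /= codeE /= sE.
- move=> R1 R2 p f s t r s1 t' r' s2 _ IHp _ IHf k inj codeE n.
  rewrite -addnA (IHp _ (fun z => inj (inl z))) => [|z]; last by rewrite codeE.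
  by rewrite (IHf _ (fun z => inj (inr (existT _ r z)))) => [|z]; rewrite ?codeE.
- move=> S R f x s t r s' _ IHf k inj codeE n; rewrite addSn /= codeE /=.
  by rewrite (IHf _ (fun z => inj (inr (existT _ x z)))) => [|z]; rewrite ?codeE.
- move=> S R f x y s t s1 t' r s' _ IHf _ IHi k inj codeE n; rewrite addSn -addnA /= codeE /=.
  rewrite (IHf _ (fun z => inj (inr (existT _ x z)))) => [|z]; last by rewrite codeE.
  exact: IHi codeE n.
Qed.

(** * Polynomial-time Hoare logic *)

(* Total correctness, uniformly in the ghost parameter [x], in time polynomial in the
   size of the initial store. *)
Definition triple X (P : X -> store -> Prop) (R : finType) (p : prog R)
    (Q : X -> R -> store -> Prop) :=
  exists2 f, poly_growth f & forall x s, P x s ->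
    exists t r s', [/\ exec p s t r s', t <= f (store_size s) & Q x r s'].

Lemma triple_consequence X Y (P' : Y -> store -> Prop) (P : X -> store -> Prop) (R : finType)
    (p : prog R) (Q' : Y -> R -> store -> Prop) (Q : X -> R -> store -> Prop) :
  triple P' p Q' ->
  (forall x s, P x s -> exists2 y, P' y s & forall r s', Q' y r s' -> Q x r s') ->
  triple P p Q.
Proof.
move=> [f pf run] weaken; exists f => // x s /weaken[y /run[t [r [s' [Ep le_t Qy]]]] imp].
by exists t, r, s'; split=> //; apply: imp.
Qed.

Lemma triple_ret X (P : X -> store -> Prop) (R : finType) (r : R)
    (Q : X -> R -> store -> Prop) :
  (forall x s, P x s -> Q x r s) -> triple P (Ret r) Q.
Proof.
move=> imp; exists id => [|x s /imp Qx]; first exact: poly_growth_id.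
by exists 0, r, s; split=> //; constructor.
Qed.

Lemma triple_family X (S R : finType) (P : S -> X -> store -> Prop) (p : S -> prog R)
    (Q : S -> X -> R -> store -> Prop) :
  (forall a, triple (P a) (p a) (Q a)) ->
  exists2 f, poly_growth f & forall a x s, P a x s ->
    exists t r s', [/\ exec (p a) s t r s', t <= f (store_size s) & Q a x r s'].
Proof.
case/fin_all_exists2=> f pf run; exists (fun n => \sum_a f a n); first exact: poly_growth_sum.
move=> a x s /run[t [r [s' [Ep le_t Qx]]]]; exists t, r, s'; split=> //.
by apply: leq_trans le_t _; rewrite (bigD1 a) //= leq_addr.
Qed.

Lemma triple_bind X (P : X -> store -> Prop) (R1 R2 : finType) (p : prog R1)
    (f : R1 -> prog R2) (M : X -> R1 -> store -> Prop) (Q : X -> R2 -> store -> Prop) :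
  triple P p M -> (forall r, triple (fun x s => M x r s) (f r) Q) -> triple P (Bind p f) Q.
Proof.
move=> [g pg run_p] /triple_family[h ph run_f].
exists (fun n => g n + h (n + g n)).
  apply: (poly_growthD pg); apply: (poly_growth_comp ph).
  exact: poly_growthD poly_growth_id pg.
move=> x s /run_p[t [r [s1 [Ep le_t /run_f[t' [r' [s2 [Ef le_t' Qx]]]]]]]].
exists (t + t'), r', s2; split=> //; first exact: ExecBind Ep Ef.
apply: leq_add => //; apply: leq_trans le_t' _; apply: ph.1.
by apply: leq_trans (exec_store_size Ep) _; rewrite leq_add2l.
Qed.

(* Every round burns some of the fuel [m]; what it burns may be turned into storage, so
   the fuel and the store together never exceed the budget [n]. *)
Lemma triple_iter X (P : X -> store -> Prop) (S R : finType) (f : S -> prog (S + R)%type)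
    (x0 : S) (Q : X -> R -> store -> Prop) (Inv : X -> nat -> S -> store -> Prop)
    (fuel : nat -> nat) :
  poly_growth fuel ->
  (forall g s, P g s -> exists2 m, m <= fuel (store_size s) & Inv g m x0 s) ->
  (forall x, triple
     (fun '(g, m, n) s => Inv g m x s /\ store_size s + m <= n) (f x)
     (fun '(g, m, n) v s => match v with
        | inl y => exists2 m', m' < m & Inv g m' y s /\ store_size s + m' <= n
        | inr r => Q g r s end)) ->
  triple P (Iter f x0) Q.
Proof.
move=> pfuel init /triple_family[h ph body].
have run g m : forall x s n, Inv g m x s -> store_size s + m <= n -> exists t r s',
    [/\ exec (Iter f x) s t r s', t <= m.+1 * (h n).+1 & Q g r s'].
  elim/ltn_ind: m => m IH x s n inv le_n.
  have [t [v [s1 [Ef le_t post]]]] := body x (g, m, n) s (conj inv le_n).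
  have {}le_t : t <= h n by apply: leq_trans le_t (ph.1 _ _ _); lia.
  case: v Ef post => [y|r] Ef => [[m' lt_m' [inv' le_n']]|Qg]; last first.
    by exists t.+1, r, s1; split=> //; [exact: ExecBreak|rewrite mulSn; lia].
  have [t' [r [s' [Ei le_t' Qg]]]] := IH m' lt_m' y s1 n inv' le_n'.
  exists (t + t').+1, r, s'; split=> //; first exact: ExecContinue Ef Ei.
  have : t' <= m * (h n).+1 by apply: leq_trans le_t' _; rewrite leq_mul2r; lia.
  by rewrite mulSn; lia.
exists (fun n => (fuel n + 1) * (h (n + fuel n) + 1)).
  have pn1 (k : nat -> nat) : poly_growth k -> poly_growth (fun n => k n + 1).
    by move=> pk; apply: poly_growthD pk (poly_growth_const 1).
  apply: poly_growthM; first exact: pn1.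
  by apply: pn1; apply: poly_growth_comp ph _; apply: poly_growthD pfuel; apply: poly_growth_id.
move=> g s /init[m le_m inv].
have [t [r [s' [Ei le_t Qg]]]] := run g m x0 s (store_size s + fuel (store_size s)) inv
  (leq_add (leqnn _) le_m).
by exists t, r, s'; split=> //; apply: leq_trans le_t _; rewrite !addn1 leq_mul.
Qed.

Fixpoint eval (R : finType) (p : prog R) s : option (R * store) :=
  match p in stack_prog _ _ R return option (R * store) with
  | Ret _ r => Some (r, s)
  | Push i a => Some (tt, upd s i (a :: s i))
  | Pop i => Some (if s i is a :: v then (Some a, upd s i v) else (None, s))
  | Bind R1 R2 p f => if eval p s is Some (r, s') then eval (f r) s' else None
  | Iter _ _ _ _ => None
  end.

Fixpoint depth (R : finType) (p : prog R) : nat :=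
  match p with
  | Bind R1 R2 p f => depth p + \max_r depth (f r)
  | _ => 1
  end.

Lemma eval_exec (R : finType) (p : prog R) s r s' : eval p s = Some (r, s') ->
  exists2 t, t <= depth p & exec p s t r s'.
Proof.
elim: p s r s' => {R} [R r0|i a|i|R1 R2 p IHp f IHf|S R f _ x] s r s' //=.
- by case=> <- <-; exists 0 => //; constructor.
- by case: r => -[<-]; exists 1 => //; constructor.
- by case sE: (s i) => [|a v] [<- <-]; exists 1 => //; constructor.
- case pE: (eval p s) => [[r1 s1]|] // fE.
  have [t le_t Ep] := IHp _ _ _ pE; have [t' le_t' Ef] := IHf _ _ _ _ fE.
  exists (t + t'); last exact: ExecBind Ep Ef.
  by apply: leq_add => //; apply: leq_trans le_t' _; apply: (leq_bigmax r1).
Qed.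

Lemma triple_eval X (P : X -> store -> Prop) (R : finType) (p : prog R)
    (Q : X -> R -> store -> Prop) :
  (forall x s, P x s -> if eval p s is Some (r, s') then Q x r s' else False) ->
  triple P p Q.
Proof.
move=> evalP; exists (fun=> depth p); first exact: poly_growth_const.
move=> x s /evalP; case E: (eval p s) => [[r s']|] // Qx.
by have [t le_t Ep] := eval_exec E; exists t, r, s'.
Qed.

Lemma triple_iter_eval X (P : X -> store -> Prop) (S R : finType) (f : S -> prog (S + R)%type)
    (x0 : S) (Q : X -> R -> store -> Prop) (Inv : X -> nat -> S -> store -> Prop)
    (fuel : nat -> nat) :
  poly_growth fuel ->
  (forall g s, P g s -> exists2 m, m <= fuel (store_size s) & Inv g m x0 s) ->
  (forall g m x s, Inv g m x s -> exists v s', eval (f x) s = Some (v, s') /\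
     match v with inl y => exists2 m', m' < m & Inv g m' y s' | inr r => Q g r s' end) ->
  triple P (Iter f x0) Q.
Proof.
move=> pfuel init body; pose D := \max_x depth (f x).
apply: (@triple_iter _ _ _ _ _ _ _ (fun g n x s => exists2 m, n = m * D.+1 & Inv g m x s)
  (fun n => fuel n * D.+1)).
- exact: poly_growthM pfuel (poly_growth_const D.+1).
- move=> g s /init[m le_m inv]; exists (m * D.+1); first by rewrite leq_mul2r le_m orbT.
  by exists m.
move=> x; exists (fun=> depth (f x)); first exact: poly_growth_const.
move=> [[g n0] n] s [[m -> inv] le_n].
have [v [s' [fE post]]] := body g m x s inv; have [t le_t Ef] := eval_exec fE.
exists t, v, s'; split=> //; case: v Ef post {fE} => [y|r] Ef // [m' lt_m' inv'].
exists (m' * D.+1); [by rewrite ltn_pmul2r|split; first by exists m'].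
have le_D : t <= D by apply: leq_trans le_t _; apply: leq_bigmax.
have := exec_store_size Ef; have : m'.+1 * D.+1 <= m * D.+1 by rewrite leq_pmul2r.
by rewrite mulSn; lia.
Qed.

End Programs.

(** * Deciding with a finite summary *)

Section Compilation.
Variables (I G : finType) (input : I) (emb : letter -> G).

Lemma store_size_input x : store_size (input_store input emb x) = size x.
Proof.
rewrite /store_size (bigD1 input) //= big1 => [|i ne_i]; last by rewrite ffunE (negbTE ne_i).
by rewrite addn0 ffunE eqxx size_rev size_map.
Qed.

Variables (X : Type) (dom : X -> Prop) (enc : X -> seq letter).

Lemma compile_decider (P : X -> Prop) (p : stack_prog I G bool) :
  triple (fun x s => dom x /\ s = input_store input emb (enc x)) p (fun x b _ => b <-> P x) ->
  poly_decidable dom enc P.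
Proof.
case=> f pf run.
pose M := stack_TM (code_of (p := p) inr inl) (entry (p := p) inr inl) input emb.
have [c [k le_T]] : exists c k, forall n, f n * ((n + f n).*2 + 7) + 2 <= c * n ^ k + c.
  apply: poly_growth_affine_monomial; apply: poly_growthD _ (poly_growth_const 2).
  apply: (poly_growthM pf); apply: poly_growthD _ (poly_growth_const 7).
  by apply: poly_growth_double; apply: poly_growthD poly_growth_id pf.
exists M, c, k => x dx; have [t [b [s' [Ep le_t bP]]]] := run x _ (conj dx erefl).
exists b; split=> //; rewrite store_size_input in le_t.
have R := @exec_run_flowchart _ _ _ (code_of (p := p) inr inl) _ _ _ _ _ _ Ep inr id
  (fun=> erefl) 0.
rewrite addn0 in R; apply: (stack_TM_runs R); apply: leq_trans (le_T _).
by rewrite leq_add2r leq_mul // leq_add2r leq_double leq_add2l.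
Qed.

(* The verdict is a function of a finite-valued summary, and needs no algorithm. *)
Lemma finite_summary_decidable (P : X -> Prop) (R : finType) (p : stack_prog I G R)
    (S : X -> R -> Prop) :
  triple (fun x s => dom x /\ s = input_store input emb (enc x)) p (fun x r _ => S x r) ->
  (forall x y r, dom x -> dom y -> S x r -> S y r -> P x -> P y) ->
  poly_decidable dom enc P.
Proof.
move=> summaryP determined.
have /fin_all_exists[decide decideP] (r : R) :
    exists b : bool, b <-> exists x, [/\ dom x, S x r & P x].
  by case: (classic (exists x, [/\ dom x, S x r & P x])) => h; [exists true|exists false].
apply: (@compile_decider _ (let* r := p in Ret (decide r))).
apply: (triple_bind (M := fun x r _ => dom x /\ S x r)) => [|r].
  by apply: triple_consequence summaryP _ => x s [dx ->]; exists x.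
apply: triple_ret => x s [dx Sx]; rewrite decideP.
split=> [[y [dy Sy Py]]|Px]; last by exists x.
exact: determined Sy Sx Py.
Qed.

End Compilation.

(** * Moving stacks *)

Definition frame (I G : finType) (ks : seq I) (s s0 : store I G) :=
  forall k, k \notin ks -> s k = s0 k.

Lemma frame_refl (I G : finType) ks (s : store I G) : frame ks s s.
Proof. by []. Qed.

Lemma frame_upd (I G : finType) ks (s s0 : store I G) i v :
  i \in ks -> frame ks s s0 -> frame ks (upd s i v) s0.
Proof. by move=> i_ks fr k k_ks; rewrite upd_neq ?fr //; apply: contraNneq k_ks => ->. Qed.

Section Scatter.
Variables (I G : finType) (g : I -> G -> G).
Local Notation store := (store I G).
Local Notation prog := (stack_prog I G).
Implicit Type s : store.

Fixpoint push_images (bs : seq I) x : prog unit :=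
  if bs is b :: bs' then let* _ := Push b (g b x) in push_images bs' x else Ret tt.

Definition scatter (a : I) (bs : seq I) : prog unit :=
  Iter (fun _ : unit => let* o := Pop a in
    if o is Some x then let* _ := push_images bs x in continue tt else break tt) tt.

Lemma eval_push_images bs x s : uniq bs -> exists s',
  [/\ eval (push_images bs x) s = Some (tt, s'),
      {in bs, forall b, s' b = g b x :: s b} & frame bs s' s].
Proof.
elim: bs s => [|b bs IH] s /=; first by exists s.
case/andP=> b_bs /(IH (upd s b (g b x :: s b)))[s' [-> pushed fr]].
exists s'; split=> // c.
  rewrite inE; case: (eqVneq c b) => [-> _|ne_cb /= c_bs]; first by rewrite fr // upd_eq.
  by rewrite pushed // upd_neq.
by rewrite inE negb_or => /andP[ne_cb c_bs]; rewrite fr // upd_neq.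
Qed.

Lemma scatterP a bs : uniq (a :: bs) ->
  triple (fun s0 s => s = s0) (scatter a bs) (fun s0 _ s => [/\ s a = [::],
    {in bs, forall b, s b = catrev (map (g b) (s0 a)) (s0 b)} & frame (a :: bs) s s0]).
Proof.
case/andP=> a_bs u_bs.
apply: (@triple_iter_eval _ _ _ _ _ _ _ _ _ (fun s0 m _ s => [/\ m = size (s a),
   {in bs, forall b, catrev (map (g b) (s a)) (s b) = catrev (map (g b) (s0 a)) (s0 b)} &
   frame (a :: bs) s s0]) id poly_growth_id).
  by move=> s0 s ->; exists (size (s0 a)) => //; apply: leq_store_size.
move=> s0 m [] s [-> moved fr] /=; case sE: (s a) moved => [|x v] moved /=.
  by exists (inr tt), s.
have [s' [-> pushed fr']] := eval_push_images x (upd s a v) u_bs.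
exists (inl tt), s'; split=> //.
have ne_a b : b \in bs -> b != a by apply: contraTneq => ->.
have s'a : s' a = v by rewrite fr' // upd_eq.
exists (size v) => //; split=> [|b b_bs|k].
- by rewrite s'a.
- by rewrite s'a pushed // upd_neq ?ne_a // -moved.
- rewrite inE negb_or => /andP[ne_k k_bs].
  by rewrite fr' // upd_neq // fr // inE negb_or ne_k.
Qed.

End Scatter.

Lemma store_size_move (I G : finType) (s : store I G) a b v rest :
  a != b -> s a = v ++ rest ->
  store_size (upd (upd s a rest) b (catrev v (s b))) = store_size s.
Proof.
move=> ab sa; have ba : b != a by rewrite eq_sym.
have := store_size_upd (upd s a rest) b (catrev v (s b)).
have := store_size_upd s a rest.
by rewrite upd_neq // sa catrevE !size_cat size_rev; lia.
Qed.

Definition transfer (I G : finType) (a b : I) : stack_prog I G unit :=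
  scatter (fun=> id) a [:: b].

Lemma transferP (I G : finType) (a b : I) : a != b ->
  triple (fun s0 s => s = s0) (transfer G a b)
    (fun s0 _ s => s = upd (upd s0 a [::]) b (catrev (s0 a) (s0 b))).
Proof.
move=> ab; have uab : uniq [:: a; b] by rewrite /= inE ab.
apply: triple_consequence (scatterP (fun=> id) uab) _ => s0 s ->; exists s0 => //.
move=> _ s' [sa sb fr]; apply/ffunP=> k; rewrite !updE.
case: (eqVneq k b) => [->|ne_kb]; first by rewrite sb ?mem_head ?map_id.
by case: (eqVneq k a) => [->|ne_ka] //; rewrite fr // !inE negb_or ne_ka.
Qed.

(** * Passes over a stack of columns *)

Definition bit_letter (b : bool) : letter := if b then l1 else l0.

Definition letter_bit (a : letter) : option bool :=
  if a == l1 then Some true else if a == l0 then Some false else None.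

Lemma bit_letterK : pcancel bit_letter letter_bit.
Proof. by case. Qed.

Section Transduction.
Variables (col S : finType) (c0 : col).
Variables (delta : S -> bool -> col -> S * col) (fin : S -> option col).

Fixpoint transduce (st : S) (ws : seq (bool * col)) : S * seq col :=
  if ws is w :: ws' then
    let d := delta st w.1 w.2 in
    let r := transduce d.1 ws' in (r.1, d.2 :: r.2)
  else (st, if fin st is Some d then [:: d] else [::]).

Fixpoint pad (u : seq bool) (cs : seq col) : seq (bool * col) :=
  if u is b :: u' then (b, head c0 cs) :: pad u' (behead cs) else map (pair false) cs.

Lemma size_pad u cs : size (pad u cs) <= size u + size cs.
Proof.
elim: u cs => [|b u IH] cs /=; first by rewrite size_map.
by have := IH (behead cs); rewrite size_behead; lia.
Qed.

Lemma size_transduce st ws : size (transduce st ws).2 <= (size ws).+1.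
Proof. by elim: ws st => [|w ws IH] st /=; [case: fin | rewrite ltnS]. Qed.

Lemma size_transduce_no_fin st ws : (forall st', fin st' = None) ->
  size (transduce st ws).2 = size ws.
Proof. by move=> no_fin; elim: ws st => [|w ws IH] st /=; rewrite ?no_fin ?IH. Qed.

End Transduction.

Section Pass.
Variables (I G col S : finType) (c0 : col).
Variables (embL : letter -> G) (decL : G -> option letter).
Variables (embC : col -> G) (decC : G -> option col).
Hypotheses (embLK : pcancel embL decL) (embCK : pcancel embC decC).
Variables (A K T : I).
Hypothesis uAKT : uniq [:: A; K; T].
Variables (delta : S -> bool -> col -> S * col) (fin : S -> option col).
Local Notation store := (store I G).
Local Notation prog := (stack_prog I G).
Implicit Type s : store.

Definition read_bits (st : S) : prog S :=
  Iter (fun st => let* o := Pop A in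
    if obind letter_bit (obind decL o) is Some b then
      let* c := Pop K in
      let d := delta st b (odflt c0 (obind decC c)) in
      let* _ := Push T (embC d.2) in continue d.1
    else break st) st.

Definition flush_columns (st : S) : prog S :=
  Iter (fun st => let* c := Pop K in
    if obind decC c is Some c' then
      let d := delta st false c' in
      let* _ := Push T (embC d.2) in continue d.1
    else
      let* _ := if fin st is Some d then Push T (embC d) else Ret tt in break st) st.

(* Reads a number (little endian) from stack [A] in lockstep with the columns on
   stack [K], rewriting the latter. *)
Definition pass (st : S) : prog S :=
  let* st1 := read_bits st in
  let* st2 := flush_columns st1 in
  let* _ := transfer G T K in
  Ret st2.

Definition num_code (u : seq bool) : seq G := map embL (rcons (map bit_letter u) lsep).

Definition mid_pass s0 a (cs tm : seq col) s :=
  [/\ s A = a, s K = map embC cs, s T = map embC tm & frame [:: A; K; T] s s0].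

(* [tm] holds the columns already rewritten, in reverse order. *)
Definition finishes_with (st : S) u cs tm (F : S * seq col) :=
  let r := transduce delta fin st (pad c0 u cs) in (r.1, catrev tm r.2) = F.

Let neqs : ((A == K) = false) * ((A == T) = false) * ((K == T) = false) *
  ((K == A) = false) * ((T == A) = false) * ((T == K) = false).
Proof.
move: uAKT; rewrite /= !inE !negb_or => /andP[/andP[AK AT] /andP[KT _]].
by rewrite !(eq_sym K) !(eq_sym T) !(negbTE AK) !(negbTE AT) !(negbTE KT).
Qed.

Lemma mid_pass_setA s0 a a' cs tm s :
  mid_pass s0 a cs tm s -> mid_pass s0 a' cs tm (upd s A a').
Proof.
case=> sA sK sT fr; split; rewrite ?updE ?eqxx ?neqs //.
by apply: frame_upd; rewrite ?mem_head.
Qed.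

Lemma mid_pass_setK s0 a cs cs' tm s :
  mid_pass s0 a cs tm s -> mid_pass s0 a cs' tm (upd s K (map embC cs')).
Proof.
case=> sA sK sT fr; split; rewrite ?updE ?eqxx ?neqs //.
by apply: frame_upd; rewrite ?inE ?eqxx ?orbT.
Qed.

Lemma mid_pass_push s0 a cs tm s d :
  mid_pass s0 a cs tm s -> mid_pass s0 a cs (d :: tm) (upd s T (embC d :: s T)).
Proof.
case=> sA sK sT fr; split; rewrite ?updE ?eqxx ?neqs ?sT //.
by apply: frame_upd; rewrite ?inE ?eqxx ?orbT.
Qed.

Definition pass_input := (store * seq bool * seq G * seq col)%type.

Lemma read_bitsP st :
  triple (fun '((s0, u, rest, cs) : pass_input) s =>
     mid_pass s0 (num_code u ++ rest) cs [::] s)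
   (read_bits st)
   (fun '(s0, u, rest, cs) st1 s => exists cs' tm, mid_pass s0 rest cs' tm s /\
     finishes_with st1 [::] cs' tm (transduce delta fin st (pad c0 u cs))).
Proof.
apply: (@triple_iter_eval _ _ _ _ _ _ _ _ _ (fun '(s0, u0, rest, cs0) m st1 s =>
  exists u cs tm, [/\ m = size u, mid_pass s0 (num_code u ++ rest) cs tm s &
   finishes_with st1 u cs tm (transduce delta fin st (pad c0 u0 cs0))]) id poly_growth_id).
  move=> [[[s0 u] rest] cs] s mid; exists (size u); last first.
    by exists u, cs, [::]; split=> //; rewrite /finishes_with -surjective_pairing.
  case: mid => sA _ _ _; apply: leq_trans (leq_store_size s A).
  by rewrite sA size_cat size_map size_rcons size_map; lia.
move=> [[[s0 u0] rest] cs0] m st1 s [u [cs [tm [-> mid fin_st1]]]] /=.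
have [-> _ _ _] := mid; case: u mid fin_st1 => [|b u] /= mid fin_st1.
  rewrite embLK /=; exists (inr st1), (upd s A rest); split=> //; exists cs, tm.
  by split=> //; apply: mid_pass_setA mid.
have {}mid := mid_pass_setA (num_code u ++ rest) mid.
rewrite embLK /= bit_letterK /=; have [_ -> _ _] := mid.
case: cs mid fin_st1 => [|c cs] /= mid fin_st1.
  do 2!eexists; split; first by []; exists (size u) => //.
  by exists u, [::], ((delta st1 b c0).2 :: tm); split=> //; apply: mid_pass_push mid.
rewrite embCK /=; do 2!eexists; split; first by []; exists (size u) => //.
exists u, cs, ((delta st1 b c).2 :: tm); split=> //.
by apply: mid_pass_push; apply: mid_pass_setK mid.
Qed.

Lemma flush_columnsP st :
  triple (fun '((s0, a, F) : store * seq G * (S * seq col)) s => exists cs tm,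
     mid_pass s0 a cs tm s /\ finishes_with st [::] cs tm F)
   (flush_columns st)
   (fun '((s0, a, F) : store * seq G * (S * seq col)) st1 s =>
     st1 = F.1 /\ mid_pass s0 a [::] (rev F.2) s).
Proof.
apply: (@triple_iter_eval _ _ _ _ _ _ _ _ _ (fun '(s0, a, F) m st s => exists cs tm,
  [/\ m = size cs, mid_pass s0 a cs tm s & finishes_with st [::] cs tm F]) id poly_growth_id).
  move=> [[s0 a] F] s [cs [tm [mid fin_st]]]; exists (size cs); last by exists cs, tm.
  by case: mid => _ sK _ _; apply: leq_trans (leq_store_size s K); rewrite sK size_map.
move=> [[s0 a] F] m st1 s [cs [tm [-> mid fin_st1]]] /=.
have [_ -> _ _] := mid; case: cs mid fin_st1 => [|c cs] /= mid; rewrite /finishes_with /=.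
  case: (fin st1) => [d|] <- /=; do 2!eexists; split; try by [];
    split=> //=; rewrite ?catrevE.
    by rewrite rev_cat revK; apply: mid_pass_push mid.
  by rewrite cats0 revK.
move=> fin_st1; rewrite embCK /=; do 2!eexists; split; first by []; exists (size cs) => //.
exists cs, ((delta st1 false c).2 :: tm); split=> //.
by apply: mid_pass_push; apply: mid_pass_setK mid.
Qed.

Lemma passP st :
  triple (fun '((s0, u, rest, cs) : pass_input) s =>
     [/\ s = s0, s A = num_code u ++ rest, s K = map embC cs & s T = [::]])
   (pass st)
   (fun '((s0, u, rest, cs) : pass_input) r s =>
     let F := transduce delta fin st (pad c0 u cs) in
     [/\ r = F.1, s = upd (upd s0 A rest) K (map embC F.2) &
      store_size s + (size u).+1 + size cs = store_size s0 + size F.2]).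
Proof.
pose F : pass_input -> S * seq col := fun '(_, u, _, cs) =>
  transduce delta fin st (pad c0 u cs).
pose input (y : pass_input) := let: (s0, u, rest, cs) := y in
  [/\ s0 A = num_code u ++ rest, s0 K = map embC cs & s0 T = [::]].
apply: (triple_bind (M := fun y st1 s => input y /\ let: (s0, _, rest, _) := y in
    exists cs tm, mid_pass s0 rest cs tm s /\ finishes_with st1 [::] cs tm (F y))) => [|st1].
  apply: triple_consequence (read_bitsP st) _ => -[[[s0 u] rest] cs] s [-> sA sK sT].
  by exists (s0, u, rest, cs); first by split=> //; exact: frame_refl.
apply: (triple_bind (M := fun y st2 s => input y /\ let: (s0, _, rest, _) := y in
    st2 = (F y).1 /\ mid_pass s0 rest [::] (rev (F y).2) s)) => [|st2].
  apply: triple_consequence (flush_columnsP st1) _ => -[[[s0 u] rest] cs] s [inp mid].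
  by exists (s0, rest, F (s0, u, rest, cs)).
apply: (triple_bind (M := fun y (_ : unit) s => input y /\ let: (s0, _, rest, _) := y in
    st2 = (F y).1 /\ s = upd (upd s0 A rest) K (map embC (F y).2))) => [|[]].
  have TK : T != K by rewrite neqs.
  apply: triple_consequence (transferP G TK) _ => -[[[s0 u] rest] cs] s [inp [-> mid]].
  exists s => // _ s' ->; split=> //; split=> //; apply/ffunP=> k; rewrite !updE.
  case: inp mid => _ _ s0T [sA sK sT fr].
  case: (eqVneq k K) => [_|ne_kK]; first by rewrite sK sT catrevE cats0 -map_rev revK.
  case: (eqVneq k T) => [->|ne_kT]; first by rewrite neqs s0T.
  by case: (eqVneq k A) => [->|ne_kA] //; rewrite fr // !inE !negb_or ne_kA ne_kK.
apply: triple_ret => -[[[s0 u] rest] cs] s [[s0A s0K _] [rE sE]]; split=> //.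
have := store_size_upd (upd s0 A rest) K (map embC (F (s0, u, rest, cs)).2).
have := store_size_upd s0 A rest.
by rewrite -sE updE neqs s0A s0K size_cat !size_map size_rcons size_map /F; lia.
Qed.

End Pass.

Section TakeNumber.
Variables (I G : finType) (embL : letter -> G) (decL : G -> option letter).
Hypothesis embLK : pcancel embL decL.
Variables a b : I.
Hypothesis ab : a != b.
Local Notation num_code := (num_code embL).

Definition take_number : stack_prog I G unit :=
  Iter (fun _ : unit => let* o := Pop a in
    if o is Some x then
      let* _ := Push b x in if decL x == Some lsep then break tt else continue tt
    else break tt) tt.

Lemma take_numberP :
  triple (fun '((s0, u, rest) : store I G * seq bool * seq G) s =>
     s = s0 /\ s0 a = num_code u ++ rest)
   take_number
   (fun '(s0, u, rest) _ s =>
     s = upd (upd s0 a rest) b (catrev (num_code u) (s0 b))).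
Proof.
apply: (@triple_iter_eval _ _ _ _ _ _ _ _ _
  (fun '((s0, u, rest) : store I G * seq bool * seq G) m (_ : unit) s =>
  s0 a = num_code u ++ rest /\ exists v moved,
  [/\ m = size v, s = upd (upd s0 a (num_code v ++ rest)) b moved &
   catrev (num_code v) moved = catrev (num_code u) (s0 b)]) id poly_growth_id).
  move=> [[s0 u] rest] s [-> s0a]; exists (size u).
    apply: leq_trans (leq_store_size s0 a).
    by rewrite s0a size_cat size_map size_rcons size_map; lia.
  split=> //; exists u, (s0 b); split=> //.
  by apply/ffunP=> k; rewrite -s0a !updE; case: eqP => [->|_] //; case: eqP => [->|].
have upd_upd (s0 : store I G) v v' x x' :
    upd (upd (upd (upd s0 a v) b x) a v') b x' = upd (upd s0 a v') b x'.
  by apply/ffunP=> k; rewrite !updE; case: eqP => // _; case: eqP.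
have ba : b != a by rewrite eq_sym.
move=> [[s0 u] rest] m [] s [s0a [v [moved [-> -> movedE]]]] /=.
rewrite !updE eqxx (negbTE ab); case: v movedE => [|x v] /= movedE; rewrite embLK /= upd_upd.
  rewrite (upd_neq _ _ ba) upd_eq; exists (inr tt).
  by eexists; split; first by []; rewrite -movedE.
have -> : (Some (bit_letter x) == Some lsep) = false by case: x {movedE}.
rewrite (upd_neq _ _ ba) upd_eq; exists (inl tt); eexists; split; first by [].
exists (size v) => //; split=> //; exists v, (embL (bit_letter x) :: moved).
by split; first by [].
Qed.

End TakeNumber.

(** * Simulation of a Turing machine by a stack program *)

Section Simulator.
Variables (I G : finType) (M : TM).
Variables (emb : tm_sym M -> G) (dec : G -> option (tm_sym M)) (embL : letter -> G).
Hypothesis embK : pcancel emb dec.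
Variables (L R O : I).
Hypothesis uLRO : uniq [:: L; R; O].
Local Notation store := (store I G).
Local Notation prog := (stack_prog I G).
Local Notation step := (@tm_step M).
Implicit Type s : store.

Definition scanned (o : option G) : tm_sym M := odflt (tm_blank M) (obind dec o).

(* The head cell is the top of [R], which is never left empty. *)
Definition simulate_step (q : tm_state M) : prog (tm_state M + unit)%type :=
  if tm_halt M q then break tt else
  let* o := Pop R in
  let: (q', a, m) := tm_delta M q (scanned o) in
  match m with
  | MStay => let* _ := Push R (emb a) in continue q'
  | MLeft => let* _ := Push R (emb a) in
             let* o := Pop L in
             let* _ := Push R (emb (scanned o)) in continue q'
  | MRight => let* _ := Push L (emb a) in
              let* o := Pop R in
              let* _ := Push R (emb (scanned o)) in continue q'
  end.

Definition emit_output : prog unit :=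
  Iter (fun _ : unit => let* o := Pop R in
    if obind (tm_out M) (obind dec o) is Some a then
      let* _ := Push O (embL a) in continue tt
    else break tt) tt.

Definition expose_head : prog unit := let* o := Pop R in Push R (emb (scanned o)).

Definition simulate : prog unit :=
  let* _ := expose_head in
  let* _ := Iter simulate_step (tm_start M) in
  emit_output.

Definition represents s0 s (c : cfg M) := let: (_, l, h, r) := c in
  [/\ s L = map emb l, s R = map emb (h :: r), s O = [::] & frame [:: L; R; O] s s0].

Let neqs : ((L == R) = false) * ((L == O) = false) * ((R == O) = false) *
  ((R == L) = false) * ((O == L) = false) * ((O == R) = false).
Proof.
move: uLRO; rewrite /= !inE !negb_or => /andP[/andP[LR LO] /andP[RO _]].
by rewrite !(eq_sym R) !(eq_sym O) !(negbTE LR) !(negbTE LO) !(negbTE RO).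
Qed.

Let frameL s0 s v : frame [:: L; R; O] s s0 -> frame [:: L; R; O] (upd s L v) s0.
Proof. by apply: frame_upd; rewrite mem_head. Qed.

Let frameR s0 s v : frame [:: L; R; O] s s0 -> frame [:: L; R; O] (upd s R v) s0.
Proof. by apply: frame_upd; rewrite !inE eqxx orbT. Qed.

Lemma eval_simulate_step s0 s c : ~~ tm_halt M (tm_state_of c) -> represents s0 s c ->
  exists2 s', eval (simulate_step (tm_state_of c)) s = Some (inl (tm_state_of (step c)), s') &
    represents s0 s' (step c).
Proof.
case: c => [[[q l] h] r] /= /negbTE running [sL sR sO fr].
rewrite /simulate_step running /= sR /= /scanned /= embK /=.
case: (tm_delta M q h) => [[q' a] []] /=.
- rewrite !updE neqs eqxx sL; case: l sL => [|b l] sL /=; rewrite ?embK /=.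
    eexists; first by [].
    by split; rewrite ?updE ?eqxx ?neqs ?sL //; do 3!apply: frameR.
  eexists; first by [].
  split; rewrite ?updE ?eqxx ?neqs //.
  by apply: frameR; apply: frameL; do 2!apply: frameR.
- rewrite !updE neqs eqxx sL; case: r sR => [|b r] sR /=; rewrite ?embK /=.
    eexists; first by [].
    by split; rewrite ?updE ?eqxx ?neqs ?sL //; apply: frameR; apply: frameL; apply: frameR.
  eexists; first by [].
  split; rewrite ?updE ?eqxx ?neqs ?sL //.
  by do 2!apply: frameR; apply: frameL; apply: frameR.
- eexists; first by [].
  by split; rewrite ?updE ?eqxx ?neqs //; do 2!apply: frameR.
Qed.

Lemma eval_expose_head s0 x :
  s0 R = [seq emb (tm_in M a) | a <- x] -> s0 L = [::] -> s0 O = [::] ->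
  exists2 s, eval expose_head s0 = Some (tt, s) &
    represents s0 s (tm_init M x).
Proof.
rewrite /tm_init; case: x => [|a x] /= sR sL sO; rewrite sR /scanned /= ?embK.
  eexists; first by [].
  by split; rewrite ?updE ?eqxx ?neqs ?sR //; apply: frameR.
eexists; first by [].
by split; rewrite ?updE ?eqxx ?neqs // -?map_comp //; do 2!apply: frameR.
Qed.

Lemma run_simulationP (T : nat -> nat) : poly_growth T ->
  triple (fun '((s0, x, y) : store * seq letter * seq letter) s =>
     [/\ size x <= store_size s, runs_to M x y (T (size x)) & represents s0 s (tm_init M x)])
  (Iter simulate_step (tm_start M))
  (fun '(s0, x, y) _ s => exists2 c, represents s0 s c & tm_output c = y).
Proof.
move=> pT; pose conf x i := iter i step (tm_init M x).
apply: (@triple_iter_eval _ _ _ _ _ _ _ _ _ (fun '(s0, x, y) m q s =>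
  runs_to M x y (T (size x)) /\ exists i, [/\ i <= T (size x), m = T (size x) - i,
    represents s0 s (conf x i) & tm_state_of (conf x i) = q]) _ pT).
  move=> [[s0 x] y] s [le_x run rep]; exists (T (size x)); first exact: pT.1.
  by split=> //; exists 0; split; rewrite ?subn0 //; case: x {le_x run rep}.
move=> [[s0 x] y] m q s [run [i [le_i -> rep qE]]]; rewrite -qE.
case halted : (tm_halt M (tm_state_of (conf x i))).
  exists (inr tt), s; split; first by rewrite /simulate_step halted.
  by exists (conf x i) => //; case: run => _ <-; rewrite (iter_tm_step_halted halted).
have [s' evalE rep'] := eval_simulate_step (negbT halted) rep.
exists (inl (tm_state_of (step (conf x i)))), s'; split=> //.
have lt_i : i < T (size x).
  rewrite ltn_neqAle le_i andbT; apply/eqP => iE; case: run => + _.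
  by rewrite -iE halted.
exists (T (size x) - i.+1); first by lia.
by split=> //; exists i.+1; rewrite /conf iterS.
Qed.

Lemma emit_outputP :
  triple (fun '((s0, y) : store * seq letter) s =>
     exists2 c, represents s0 s c & tm_output c = y)
  emit_output
  (fun '(s0, y) _ s => s O = rev (map embL y) /\ frame [:: L; R; O] s s0).
Proof.
apply: (@triple_iter_eval _ _ _ _ _ _ _ _ _ (fun '(s0, y) m (_ : unit) s => exists r out,
  [/\ s R = map emb r, s O = map embL out, frame [:: L; R; O] s s0, m = size r &
   catrev out (read_out r) = y]) id poly_growth_id).
  move=> [s0 y] s [[[[q l] h] r] [sL sR sO fr] outE]; exists (size (h :: r)).
    by apply: leq_trans (leq_store_size s R); rewrite sR size_map.
  by exists (h :: r), [::].
move=> [s0 y] m [] s [r [out [sR sO fr -> <-]]] /=; rewrite sR; case: r sR => [|h r] sR /=.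
  by exists (inr tt), s; rewrite sO catrevE cats0 map_rev revK.
rewrite embK /=; case: (tm_out M h) => [a|] /=; do 2!eexists; split; try by [].
  exists (size r) => //; exists r, (a :: out); split=> //.
  - by rewrite !updE ?eqxx ?neqs.
  - by rewrite !updE ?eqxx ?neqs sO.
  - by do 2!(apply: frame_upd; first by rewrite !inE eqxx ?orbT).
by rewrite /= updE neqs sO catrevE cats0 map_rev revK; split=> //; apply: frameR.
Qed.

Lemma simulateP (T : nat -> nat) : poly_growth T ->
  triple (fun '((s0, x, y) : store * seq letter * seq letter) s =>
     [/\ s = s0, runs_to M x y (T (size x)), s R = [seq emb (tm_in M a) | a <- x],
         s L = [::] & s O = [::]])
  simulate
  (fun '(s0, x, y) _ s => s O = rev (map embL y) /\ frame [:: L; R; O] s s0).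
Proof.
move=> pT.
apply: (triple_bind (M := fun '((s0, x, y) : store * seq letter * seq letter) _ s =>
    [/\ size x <= store_size s, runs_to M x y (T (size x)) & represents s0 s (tm_init M x)])).
  apply: triple_eval => -[[s0 x] y] s [-> run sR sL sO].
  have [s' -> rep] := eval_expose_head sR sL sO; split=> //.
  case: (x) rep => // a x' [_ s'R _ _]; apply: leq_trans (leq_store_size s' R).
  by rewrite s'R /= !size_map.
case; apply: (triple_bind (M := fun '((s0, x, y) : store * seq letter * seq letter) _ s =>
    exists2 c, represents s0 s c & tm_output c = y)) => [|[]].
  by apply: triple_consequence (run_simulationP pT) _ => -[[s0 x] y] s pre; exists (s0, x, y).
by apply: triple_consequence emit_outputP _ => -[[s0 x] y] s pre; exists (s0, y).
Qed.

End Simulator.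

(** * Arithmetic on columns *)

Definition bits_val (u : seq bool) : nat := foldr (fun (b : bool) n => b + n.*2) 0 u.

Lemma bits_val_bin n f : n <= f -> bits_val (bin f n) = n.
Proof.
elim: f n => [|f IH] n /=; first by case: n.
case: eqP => [-> //|n_neq0] le_nf /=; rewrite IH ?odd_double_half //.
by have := odd_double_half n; lia.
Qed.

Section Columns.
Variable T : finType.
Local Notation col := {ffun T -> bool}.
Local Notation c0 := ([ffun => false] : col).
Implicit Types (c : col) (cs : seq col) (u : seq bool) (x : T).

Definition column_val cs x : nat := bits_val [seq (c : col) x | c <- cs].

Definition add_delta (mask : pred T) (carry : col) (b : bool) c : col * col :=
  ([ffun x => [|| c x && carry x, c x && (b && mask x) | carry x && (b && mask x)]],
   [ffun x => c x (+) carry x (+) (b && mask x)]).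

Lemma add_val mask carry u cs x :
  column_val (transduce (add_delta mask) Some carry (pad c0 u cs)).2 x =
  column_val cs x + (if mask x then bits_val u else 0) + carry x.
Proof.
rewrite /column_val; elim: u carry cs => [|b u IH] carry cs /=.
  elim: cs carry => [|c cs IH] carry /=; first by case: ifP; case: (carry x).
  by rewrite IH !ffunE /=; case: ifP; case: (c x); case: (carry x) => /= *; lia.
rewrite IH !ffunE; case: cs => [|c cs] /=; rewrite ?ffunE.
  by case: ifP; case: b; case: (carry x) => /= *; lia.
by case: ifP; case: b; case: (carry x); case: (c x) => /= *; lia.
Qed.

Definition match_delta (equal : col) (b : bool) c : col * col :=
  ([ffun x => equal x && (c x == b)], c).

Lemma match_val equal u cs x :
  column_val (transduce match_delta (fun=> None) equal (pad c0 u cs)).2 x = column_val cs x.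
Proof.
rewrite /column_val; elim: u equal cs => [|b u IH] equal cs /=.
  by elim: cs equal => //= c cs IH equal; rewrite IH.
by rewrite IH; case: cs => [|c cs] /=; rewrite ?ffunE.
Qed.

Lemma match_equal equal u cs x :
  (transduce match_delta (fun=> None) equal (pad c0 u cs)).1 x =
  equal x && (column_val cs x == bits_val u).
Proof.
rewrite /column_val; elim: u equal cs => [|b u IH] equal cs /=.
  elim: cs equal => [|c cs IH] equal /=; first by rewrite andbT.
  by rewrite IH !ffunE; case: (c x); case: (equal x) => //=; lia.
rewrite IH !ffunE -andbA; congr (_ && _); case: cs => [|c cs] /=; rewrite ?ffunE.
  by case: b => /=; lia.
by case: (c x); case: b => /=; lia.
Qed.

Definition compare_delta (cmp : {ffun T * T -> bool}) (_ : bool) c :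
    {ffun T * T -> bool} * col :=
  ([ffun p => if c p.1 == c p.2 then cmp p else c p.2], c).

Lemma compare_val cmp u cs x :
  column_val (transduce compare_delta (fun=> None) cmp (pad c0 u cs)).2 x = column_val cs x.
Proof.
rewrite /column_val; elim: u cmp cs => [|b u IH] cmp cs /=.
  by elim: cs cmp => //= c cs IH cmp; rewrite IH.
by rewrite IH; case: cs => [|c cs] /=; rewrite ?ffunE.
Qed.

Lemma compare_le cmp u cs p :
  (transduce compare_delta (fun=> None) cmp (pad c0 u cs)).1 p =
  (column_val cs p.1 < column_val cs p.2) ||
  (column_val cs p.1 == column_val cs p.2) && cmp p.
Proof.
rewrite /column_val; elim: u cmp cs => [|b u IH] cmp cs /=.
  elim: cs cmp => [|c cs IH] cmp //=; rewrite IH !ffunE.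
  by case: (c p.1); case: (c p.2); case: (cmp p) => /=; lia.
rewrite IH !ffunE; case: cs => [|c cs] /=; first by rewrite !ffunE eqxx.
by case: (c p.1); case: (c p.2); case: (cmp p) => /=; lia.
Qed.

End Columns.

Lemma enc_nats_cons n l : enc_nats (n :: l) = enc_nat n ++ enc_nats l.
Proof. by []. Qed.

Lemma enc_nats_cat l l' : enc_nats (l ++ l') = enc_nats l ++ enc_nats l'.
Proof. by rewrite /enc_nats map_cat flatten_cat. Qed.

Lemma size_enc_nat n : size (enc_nat n) = (size (bin n n)).+1.
Proof. by rewrite /enc_nat size_cat size_map addn1. Qed.

Lemma leq_size_enc_nats l : size l <= size (enc_nats l).
Proof.
elim: l => // n l IH; rewrite enc_nats_cons size_cat size_enc_nat addSn ltnS.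
exact: leq_trans IH (leq_addl _ _).
Qed.

Definition enc_voters (V : seq (nat * seq nat)) := enc_nats (flatten [seq x.1 :: x.2 | x <- V]).

Lemma enc_voters_cons x V : enc_voters (x :: V) = enc_nat x.1 ++ enc_nats x.2 ++ enc_voters V.
Proof. by rewrite /enc_voters /= enc_nats_cons enc_nats_cat. Qed.

Lemma leq_size_enc_voters V : size V <= size (enc_voters V).
Proof.
elim: V => // x V IH; rewrite enc_voters_cons size_cat size_enc_nat addSn ltnS size_cat.
by apply: leq_trans IH _; rewrite addnA leq_addl.
Qed.

Lemma enc_instE x : enc_inst x =
  enc_nat (size (icands x)) ++ enc_nats (icands x) ++ enc_nat (idist x) ++
  enc_nat (size (ivoters x)) ++ enc_voters (ivoters x) ++
  enc_nat (size (imanip x)) ++ enc_nats (imanip x).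
Proof. by rewrite /enc_inst /enc_voters !(enc_nats_cons, enc_nats_cat) -!catA. Qed.

(** * Reading numbers into registers *)

Section ElectionProgram.
Variables (j : nat) (MC MP : TM).

Definition reg : finType := ('I_j + ('I_j * 'I_j * bool + bool))%type.
Definition name_reg (i : 'I_j) : reg := inl i.
Definition weight_reg (a b : 'I_j) (e : bool) : reg := inr (inl (a, b, e)).
Definition total_reg : reg := inr (inr true).
Definition seen_reg : reg := inr (inr false).

Definition column : finType := {ffun reg -> bool}.
Definition no_bits : column := [ffun => false].

Definition sym : finType := (letter + column + (tm_sym MC + tm_sym MP))%type.
Definition of_letter (a : letter) : sym := inl (inl a).
Definition to_letter (g : sym) : option letter := if g is inl (inl a) then Some a else None.
Definition of_column (c : column) : sym := inl (inr c).
Definition to_column (g : sym) : option column := if g is inl (inr c) then Some c else None.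
Definition of_symC (a : tm_sym MC) : sym := inr (inl a).
Definition to_symC (g : sym) : option (tm_sym MC) := if g is inr (inl a) then Some a else None.
Definition of_symP (a : tm_sym MP) : sym := inr (inr a).
Definition to_symP (g : sym) : option (tm_sym MP) := if g is inr (inr a) then Some a else None.

Definition stack : finType := 'I_10.
Local Notation stack_nr i := (@Ordinal 10 i isT : stack).
Definition hold := stack_nr 0.
Definition unread := stack_nr 1.
Definition columns := stack_nr 2.
Definition scratch := stack_nr 3.
Definition leftC := stack_nr 4.
Definition rightC := stack_nr 5.
Definition outC := stack_nr 6.
Definition leftP := stack_nr 7.
Definition rightP := stack_nr 8.
Definition outP := stack_nr 9.

Local Notation store := (store stack sym).
Local Notation prog := (stack_prog stack sym).
Implicit Types (s rest : store) (regs : reg -> nat) (w : seq letter).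

Definition memory_stacks := [:: unread; columns; scratch].
Definition off_memory (i : stack) := i \notin memory_stacks.

Definition memory w regs rest s := exists cs,
  [/\ s unread = map of_letter w, s columns = map of_column cs, s scratch = [::],
      column_val cs =1 regs & frame memory_stacks s rest].

Lemma memory_eq_regs w regs regs' rest s :
  regs =1 regs' -> memory w regs rest s -> memory w regs' rest s.
Proof.
by move=> regsE [cs [unreadE columnsE scratchE csE fr]]; exists cs; split=> // t; rewrite csE.
Qed.

Lemma memory_upd_unread w w' regs rest s :
  memory w regs rest s -> memory w' regs rest (upd s unread (map of_letter w')).
Proof.
case=> cs [unreadE columnsE scratchE csE fr]; exists cs; rewrite !updE eqxx; split=> //.
by apply: frame_upd; rewrite ?mem_head.
Qed.

Lemma memory_upd w regs rest s i v : off_memory i ->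
  memory w regs rest s -> memory w regs (upd rest i v) (upd s i v).
Proof.
rewrite /off_memory !inE !negb_or => /and3P[iu ic isc] [cs [unreadE columnsE scratchE csE fr]].
exists cs; rewrite !upd_neq 1?eq_sym //; split=> // k k_out.
by rewrite !updE; case: eqP => // _; apply: fr.
Qed.

Lemma memory_at w regs rest s i : off_memory i -> memory w regs rest s -> s i = rest i.
Proof. by move=> i_out [cs [_ _ _ _ fr]]; apply: fr. Qed.

Definition reading (S : finType) (delta : S -> bool -> column -> S * column)
    (fin : S -> option column) (st : S) : prog S :=
  pass no_bits to_letter of_column to_column unread columns scratch delta fin st.

Definition ghost := (seq letter * (reg -> nat) * store * nat)%type.

Lemma enc_nat_num_code n : map of_letter (enc_nat n) = num_code of_letter (bin n n).
Proof. by rewrite /enc_nat /num_code -cats1. Qed.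

Lemma readingP (S : finType) (delta : S -> bool -> column -> S * column) fin st
    (upd_val : nat -> (reg -> nat) -> reg -> nat) (res : nat -> (reg -> nat) -> S -> Prop)
    extra :
  (forall n regs cs, column_val cs =1 regs ->
     let F := transduce delta fin st (pad no_bits (bin n n) cs) in
     [/\ column_val F.2 =1 upd_val n regs, size F.2 <= size (bin n n) + size cs + extra &
      res n regs F.1]) ->
  triple (fun '((n, (w, regs, rest, B)) : nat * ghost) s =>
     memory (enc_nat n ++ w) regs rest s /\ store_size s <= B)
   (reading delta fin st)
   (fun '(n, (w, regs, rest, B)) r s =>
     [/\ res n regs r, memory w (upd_val n regs) rest s & store_size s < B + extra]).
Proof.
move=> spec; apply: triple_consequence (@passP _ _ _ _ no_bits of_letter to_letter of_column
  to_column (fun=> erefl) (fun=> erefl) unread columns scratch isT delta fin st) _.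
move=> [n [[[w regs] rest] B]] s [[cs [unreadE columnsE scratchE csE fr]] le_B].
exists (s, bin n n, map of_letter w, cs).
  by split=> //; rewrite unreadE map_cat enc_nat_num_code.
move=> r s' [-> s'E sizeE]; set F := transduce _ _ _ _ in s'E sizeE *.
have [regsE sizeF resF] := spec n regs cs csE; split=> //.
  exists F.2; rewrite s'E !updE; split=> //.
  by do 2!(apply: frame_upd; first by rewrite !inE).
by move: sizeF sizeE le_B; move: (size F.2) (size cs); lia.
Qed.

Definition read_add (mask carry : pred reg) : prog unit :=
  let* _ := reading (add_delta mask) Some [ffun t => carry t] in Ret tt.

Definition read_match : prog column := reading (@match_delta reg) (fun=> None) [ffun => true].

Definition push_zero : prog unit := Push unread (of_letter lsep).

Definition increment (mask : pred reg) : prog unit :=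
  let* _ := push_zero in read_add pred0 mask.

Definition compare : prog {ffun reg * reg -> bool} :=
  let* _ := push_zero in reading (@compare_delta reg) (fun=> None) [ffun => true].

Lemma read_addP mask carry :
  triple (fun '((n, (w, regs, rest, B)) : nat * ghost) s =>
     memory (enc_nat n ++ w) regs rest s /\ store_size s <= B)
   (read_add mask carry)
   (fun '(n, (w, regs, rest, B)) _ s =>
     memory w (fun t => regs t + (if mask t then n else 0) + carry t) rest s /\
     store_size s <= B).
Proof.
pose upd_val n regs t := regs t + (if mask t then n else 0) + carry t.
apply: (triple_bind (M := fun '((n, (w, regs, rest, B)) : nat * ghost) _ s =>
  memory w (upd_val n regs) rest s /\ store_size s <= B)) => [|r].
  apply: triple_consequence (readingP (upd_val := upd_val) (res := fun _ _ _ => True)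
    (extra := 1) _) _.
    move=> n regs cs csE F; split=> // [t|].
      by rewrite /F add_val csE bits_val_bin // ffunE.
    by apply: leq_trans (size_transduce _ _ _ _) _; rewrite addn1 ltnS size_pad.
  move=> [n [[[w regs] rest] B]] s pre; exists (n, (w, regs, rest, B)) => // r s' [_ memE].
  by rewrite addn1 ltnS.
by apply: triple_ret => -[n [[[w regs] rest] B]].
Qed.

Lemma read_matchP :
  triple (fun '((n, (w, regs, rest, B)) : nat * ghost) s =>
     memory (enc_nat n ++ w) regs rest s /\ store_size s <= B)
   read_match
   (fun '(n, (w, regs, rest, B)) r s =>
     [/\ r = [ffun t => regs t == n], memory w regs rest s & store_size s < B]).
Proof.
apply: triple_consequence (readingP (upd_val := fun _ regs => regs)
  (res := fun n regs r => r = [ffun t => regs t == n]) (extra := 0) _) _.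
  move=> n regs cs csE F; split=> [t||]; first by rewrite /F match_val.
    by rewrite /F size_transduce_no_fin // addn0 size_pad.
  by apply/ffunP=> t; rewrite /F match_equal !ffunE csE bits_val_bin.
move=> [n [[[w regs] rest] B]] s pre; exists (n, (w, regs, rest, B)) => // r s' [].
by rewrite addn0.
Qed.

Lemma push_zeroP :
  triple (fun '((w, regs, rest, B) : ghost) s => memory w regs rest s /\ store_size s <= B)
   push_zero
   (fun '(w, regs, rest, B) _ s => memory (enc_nat 0 ++ w) regs rest s /\ store_size s <= B.+1).
Proof.
apply: triple_eval => -[[[w regs] rest] B] s [memE le_B] /=; have [cs [unreadE _ _ _ _]] := memE.
rewrite unreadE; split; first exact: (memory_upd_unread (lsep :: w) memE).
by have := store_size_upd s unread (map of_letter (lsep :: w)); rewrite unreadE /=; lia.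
Qed.

Lemma incrementP mask :
  triple (fun '((w, regs, rest, B) : ghost) s => memory w regs rest s /\ store_size s <= B)
   (increment mask)
   (fun '(w, regs, rest, B) _ s =>
     memory w (fun t => regs t + mask t) rest s /\ store_size s <= B.+1).
Proof.
apply: (triple_bind (M := fun '((w, regs, rest, B) : ghost) _ s =>
  memory (enc_nat 0 ++ w) regs rest s /\ store_size s <= B.+1)) => [|[]].
  apply: triple_consequence push_zeroP _ => -[[[w regs] rest] B] s pre.
  by exists (w, regs, rest, B).
apply: triple_consequence (read_addP pred0 mask) _ => -[[[w regs] rest] B] s pre.
exists (0, (w, regs, rest, B.+1)) => // _ s' [memE le_B]; split=> //.
by apply: memory_eq_regs memE => t; rewrite addn0.
Qed.

Lemma compareP :
  triple (fun '((w, regs, rest, B) : ghost) s => memory w regs rest s /\ store_size s <= B)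
   compare
   (fun '(w, regs, rest, B) r s =>
     [/\ r = [ffun p => regs p.1 <= regs p.2], memory w regs rest s & store_size s <= B]).
Proof.
apply: (triple_bind (M := fun '((w, regs, rest, B) : ghost) _ s =>
  memory (enc_nat 0 ++ w) regs rest s /\ store_size s <= B.+1)) => [|[]].
  apply: triple_consequence push_zeroP _ => -[[[w regs] rest] B] s pre.
  by exists (w, regs, rest, B).
apply: triple_consequence (readingP (upd_val := fun _ regs => regs)
  (res := fun _ regs r => r = [ffun p => regs p.1 <= regs p.2]) (extra := 0) _) _.
  move=> n regs cs csE F; split=> [t||]; first by rewrite /F compare_val.
    by rewrite /F size_transduce_no_fin // addn0 size_pad.
  by apply/ffunP=> p; rewrite /F compare_le !ffunE !csE andbT orbC -leq_eqVlt.
move=> [[[w regs] rest] B] s pre; exists (0, (w, regs, rest, B.+1)) => // r s' [rE memE].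
by rewrite addn0.
Qed.

Lemma map_nth_enum_ord (C : seq nat) :
  size C = j -> [seq nth 0 C i | i : 'I_j <- enum 'I_j] = C.
Proof. by move=> sC; rewrite (map_comp (nth 0 C)) val_enum_ord -sC -/(mkseq _ _) mkseq_nth. Qed.

(* The position among the candidates, [j] if there is none. *)
Definition position (equal : column) : 'I_j.+1 :=
  inord (find (fun i => equal (name_reg i)) (enum 'I_j)).

Definition names_loaded (C : seq nat) regs := forall i, regs (name_reg i) = nth 0 C i.

Lemma position_index (C : seq nat) regs c : size C = j -> names_loaded C regs ->
  position [ffun t => regs t == c] = index c C :> nat.
Proof.
move=> sC loaded; rewrite /position (eq_find (a2 := fun i : 'I_j => nth 0 C i == c)) => [|i].
  by rewrite -(find_map _ (pred1 c)) map_nth_enum_ord // inordK // ltnS -sC index_size.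
by rewrite ffunE loaded.
Qed.

Definition read_position : prog 'I_j.+1 := let* equal := read_match in Ret (position equal).

Fixpoint read_positions n : prog (n.-tuple 'I_j.+1) :=
  if n is n'.+1 then
    let* i := read_position in
    let* t := read_positions n' in
    Ret [tuple of i :: t]
  else Ret [tuple].

Definition positions (C l : seq nat) : seq nat := [seq index c C | c <- l].

Lemma read_positionP :
  triple (fun '((C, c, (w, regs, rest, B)) : seq nat * nat * ghost) s =>
     [/\ size C = j, names_loaded C regs, memory (enc_nat c ++ w) regs rest s &
      store_size s <= B])
   read_position
   (fun '(C, c, (w, regs, rest, B)) i s =>
     [/\ i = index c C :> nat, memory w regs rest s & store_size s <= B]).
Proof.
apply: (triple_bind (M := fun '((C, c, (w, regs, rest, B)) : seq nat * nat * ghost) equal s =>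
    [/\ position equal = index c C :> nat, memory w regs rest s & store_size s <= B]))
    => [|equal].
  apply: triple_consequence read_matchP _.
  move=> [[C c] [[[w regs] rest] B]] s [sC loaded memE le_B].
  exists (c, (w, regs, rest, B)) => // equal s' [-> memE' lt_B]; split=> //; last exact: ltnW.
  exact: position_index.
by apply: triple_ret => -[[C c] [[[w regs] rest] B]].
Qed.

Lemma read_positionsP n :
  triple (fun '((C, l, (w, regs, rest, B)) : seq nat * seq nat * ghost) s =>
     [/\ size C = j, names_loaded C regs & size l = n] /\
     memory (enc_nats l ++ w) regs rest s /\ store_size s <= B)
   (read_positions n)
   (fun '(C, l, (w, regs, rest, B)) t s =>
     [/\ map val t = positions C l, memory w regs rest s & store_size s <= B]).
Proof.
elim: n => [|n IH] /=.
  by apply: triple_ret => -[[C l] [[[w regs] rest] B]] s [[_ _ /size0nil ->] []].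
apply: (triple_bind (M :=
  fun '((C, l, (w, regs, rest, B)) : seq nat * seq nat * ghost) (i : 'I_j.+1) s =>
    exists c l', [/\ l = c :: l', i = index c C :> nat, memory (enc_nats l' ++ w) regs rest s,
     store_size s <= B & [/\ size C = j, names_loaded C regs & size l' = n]])) => [|i].
  apply: triple_consequence read_positionP _.
  move=> [[C [|c l]] [[[w regs] rest] B]] s [[sC loaded] //= [sl] []].
  rewrite enc_nats_cons -catA => memE le_B.
  exists (C, c, (enc_nats l ++ w, regs, rest, B)) => // i s' [iE memE' le_B'].
  by exists c, l.
apply: (triple_bind (M :=
  fun '((C, l, (w, regs, rest, B)) : seq nat * seq nat * ghost) (t : n.-tuple 'I_j.+1) s =>
    [/\ nat_of_ord i :: map val t = positions C l, memory w regs rest s & store_size s <= B]))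
    => [|t].
  apply: triple_consequence IH _ => -[[C l] [[[w regs] rest] B]] s.
  case=> [c [l' [-> iE memE le_B sizes]]].
  by exists (C, l', (w, regs, rest, B)) => // t s' [tE memE' le_B']; rewrite tE iE.
by apply: triple_ret => -[[C l] [[[w regs] rest] B]].
Qed.

Lemma take_number_memoryP :
  triple (fun '((n, (w, regs, rest, B)) : nat * ghost) s =>
     memory (enc_nat n ++ w) regs rest s /\ store_size s <= B)
   (take_number to_letter unread hold)
   (fun '(n, (w, regs, rest, B)) _ s =>
     memory w regs (upd rest hold (catrev (map of_letter (enc_nat n)) (rest hold))) s /\
     store_size s <= B).
Proof.
apply: triple_consequence (take_numberP (embL := of_letter) (decL := to_letter) (fun=> erefl)
  (isT : unread != hold)) _ => -[n [[[w regs] rest] B]] s [memE le_B].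
have [cs [unreadE _ _ _ _]] := memE.
have sE : s unread = map of_letter (enc_nat n) ++ map of_letter w by rewrite unreadE map_cat.
exists (s, bin n n, map of_letter w); first by rewrite -enc_nat_num_code.
rewrite -enc_nat_num_code => _ s' ->; split; last by rewrite store_size_move.
rewrite -(memory_at (isT : off_memory hold) memE); apply: memory_upd => //.
exact: memory_upd_unread memE.
Qed.

Lemma return_to_inputP src : off_memory src ->
  triple (fun '((u, (w, regs, rest, B)) : seq letter * ghost) s =>
     [/\ rest src = rev (map of_letter u), memory w regs rest s & store_size s <= B])
   (transfer sym src unread)
   (fun '(u, (w, regs, rest, B)) _ s =>
     memory (u ++ w) regs (upd rest src [::]) s /\ store_size s <= B).
Proof.
move=> src_out; have src_unread : src != unread by apply: contraNneq src_out => ->.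
apply: triple_consequence (transferP sym src_unread) _.
move=> [u [[[w regs] rest] B]] s [restE memE le_B]; exists s => // _ s' ->.
have srcE := memory_at src_out memE; have [cs [unreadE _ _ _ _]] := memE.
split; last by rewrite store_size_move // cats0.
have -> : catrev (s src) (s unread) = map of_letter (u ++ w).
  by rewrite srcE restE unreadE catrevE revK map_cat.
by apply: (memory_upd_unread (w := w)); apply: memory_upd.
Qed.

Fixpoint take_numbers n : prog unit :=
  if n is n'.+1 then let* _ := take_number to_letter unread hold in take_numbers n' else Ret tt.

Lemma take_numbersP n :
  triple (fun '((l, (w, regs, rest, B)) : seq nat * ghost) s =>
     size l = n /\ memory (enc_nats l ++ w) regs rest s /\ store_size s <= B)
   (take_numbers n)
   (fun '(l, (w, regs, rest, B)) _ s =>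
     memory w regs (upd rest hold (catrev (map of_letter (enc_nats l)) (rest hold))) s).
Proof.
elim: n => [|n IH] /=.
  apply: triple_ret => -[l [[[w regs] rest] B]] s [/size0nil -> [memE _]] /=.
  suff -> : upd rest hold (rest hold) = rest by [].
  by apply/ffunP=> k; rewrite updE; case: eqP => // ->.
pose moved (c : nat) rest := upd rest hold (catrev (map of_letter (enc_nat c)) (rest hold)).
apply: (triple_bind (M := fun '((l, (w, regs, rest, B)) : seq nat * ghost) (_ : unit) s =>
    exists c l', [/\ l = c :: l', size l' = n, memory (enc_nats l' ++ w) regs (moved c rest) s &
      store_size s <= B])) => [|[]].
  apply: triple_consequence take_number_memoryP _.
  move=> [[|c l] [[[w regs] rest] B]] s [//= [sl] []].
  rewrite enc_nats_cons -catA => memE le_B; exists (c, (enc_nats l ++ w, regs, rest, B)) => //.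
  by move=> _ s' [memE' le_B']; exists c, l.
apply: triple_consequence IH _ => -[l [[[w regs] rest] B]] s [c [l' [-> sl memE le_B]]].
exists (l', (w, regs, moved c rest, B)) => // _ s'.
rewrite /moved upd_eq enc_nats_cons map_cat catrev_catl.
suff -> v v' : upd (upd rest hold v) hold v' = upd rest hold v' by [].
by apply/ffunP=> k; rewrite !updE; case: eqP.
Qed.

Fixpoint read_names (l : seq 'I_j) : prog unit :=
  if l is i :: l' then
    let* _ := read_add (pred1 (name_reg i)) pred0 in read_names l'
  else Ret tt.

Lemma read_namesP l :
  triple (fun '((C, (w, regs, rest, B)) : seq nat * ghost) s =>
     memory (enc_nats [seq nth 0 C i | i : 'I_j <- l] ++ w) regs rest s /\ store_size s <= B)
   (read_names l)
   (fun '(C, (w, regs, rest, B)) _ s =>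
     memory w (fun t => regs t + \sum_(i <- l) (if t == name_reg i then nth 0 C i else 0))
       rest s).
Proof.
elim: l => [|i l IH] /=.
  apply: triple_ret => -[C [[[w regs] rest] B]] s [memE _]; apply: memory_eq_regs memE => t.
  by rewrite big_nil addn0.
pose named (C : seq nat) regs (t : reg) := regs t + (if t == name_reg i then nth 0 C i else 0).
apply: (triple_bind (M := fun '((C, (w, regs, rest, B)) : seq nat * ghost) (_ : unit) s =>
  memory (enc_nats [seq nth 0 C i | i : 'I_j <- l] ++ w) (named C regs) rest s /\
  store_size s <= B)) => [|[]].
  apply: triple_consequence (read_addP _ _) _ => -[C [[[w regs] rest] B]] s.
  rewrite enc_nats_cons -catA => pre.
  exists (nth 0 C i, (enc_nats [seq nth 0 C i | i : 'I_j <- l] ++ w, regs, rest, B)) => //.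
  by move=> _ s' [memE le_B]; split=> //; apply: memory_eq_regs memE => t; rewrite addn0.
apply: triple_consequence IH _ => -[C [[[w regs] rest] B]] s pre.
exists (C, (w, named C regs, rest, B)) => // _ s'; apply: memory_eq_regs => t.
by rewrite big_cons addnA.
Qed.

(** * Running the tie-breaking machines *)

Section TieBreak.
Variables (M : TM) (of_sym : tm_sym M -> sym) (to_sym : sym -> option (tm_sym M)).
Hypothesis of_symK : pcancel of_sym to_sym.
Variables L R O : stack.
Hypotheses (uLRO : uniq [:: L; R; O]).
Hypotheses (L_out : off_memory L) (R_out : off_memory R) (O_out : off_memory O).

Definition tape_loaded (C : seq nat) rest :=
  [/\ rest L = [::], rest R = [seq of_sym (tm_in M a) | a <- enc_nats C] & rest O = [::]].

Definition read_tie_break n : prog (n.-tuple 'I_j.+1) :=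
  let* _ := simulate of_sym to_sym of_letter L R O in
  let* _ := transfer sym O unread in
  read_positions n.

Definition tie_break_frame := memory_stacks ++ [:: L; R; O].

Definition tie_break_input := (seq nat * (seq letter * (reg -> nat) * store))%type.

Lemma memory_frame w regs rest s s' : memory w regs rest s -> frame [:: L; R; O] s' s ->
  memory w regs s' s' /\ frame tie_break_frame s' rest.
Proof.
case=> cs [unreadE columnsE scratchE csE fr] fr'; split.
  have at_memory i : i \in memory_stacks -> s' i = s i.
    move=> i_mem; apply: fr'; rewrite !inE; apply: contraL i_mem.
    by case/or3P=> /eqP ->.
  by exists cs; rewrite !at_memory.
by move=> k; rewrite mem_cat negb_or => /andP[k_out k_LRO]; rewrite fr' // fr.
Qed.

Lemma read_tie_breakP n (f : seq nat -> seq nat) (T : nat -> nat) : poly_growth T ->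
  triple (fun '((C, (w, regs, rest)) : tie_break_input) s =>
     [/\ runs_to M (enc_nats C) (enc_nats (f C)) (T (size (enc_nats C))), size (f C) = n &
         tape_loaded C rest] /\
     [/\ size C = j, names_loaded C regs & memory w regs rest s])
   (read_tie_break n)
   (fun '(C, (w, regs, rest)) t s => map val t = positions C (f C) /\
     exists2 rest', memory w regs rest' s & frame tie_break_frame rest' rest).
Proof.
move=> pT.
apply: (triple_bind (M := fun '((C, (w, regs, rest)) : tie_break_input) (_ : unit) s =>
    [/\ size (f C) = n, size C = j & names_loaded C regs] /\
    exists rest', [/\ rest' O = rev (map of_letter (enc_nats (f C))), memory w regs rest' s &
      frame tie_break_frame rest' rest])) => [|[]].
  apply: triple_consequence (simulateP of_letter of_symK uLRO pT) _.
  move=> [C [[w regs] rest]] s [[run sf [restL restR restO]] [sC loaded memE]].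
  exists (s, enc_nats C, enc_nats (f C)); first by rewrite !(memory_at _ memE).
  by move=> _ s' [s'O /(memory_frame memE)[memE' fr]]; split=> //; exists s'.
apply: (triple_bind (M := fun '((C, (w, regs, rest)) : tie_break_input) (_ : unit) s =>
    [/\ size (f C) = n, size C = j & names_loaded C regs] /\
    exists2 rest', memory (enc_nats (f C) ++ w) regs rest' s & frame tie_break_frame rest' rest))
    => [|[]].
  apply: triple_consequence (return_to_inputP O_out) _.
  move=> [C [[w regs] rest]] s [sizes [rest' [rest'O memE fr]]].
  exists (enc_nats (f C), (w, regs, rest', store_size s)) => // _ s' [memE' _]; split=> //.
  exists (upd rest' O [::]) => //; apply: frame_upd fr.
  by rewrite !inE eqxx !orbT.
apply: triple_consequence (read_positionsP n) _.
move=> [C [[w regs] rest]] s [[sf sC loaded] [rest' memE fr]].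
exists (C, f C, (w, regs, rest', store_size s)) => // t s' [tE memE' _]; split=> //.
by exists rest'.
Qed.

End TieBreak.

Definition load_map (dst : stack) (g : sym) : sym :=
  if to_letter g is Some a then
    if dst == rightC then of_symC (tm_in MC a)
    else if dst == rightP then of_symP (tm_in MP a) else g
  else g.

Definition load_candidates : prog unit :=
  let* _ := take_numbers j in
  let* _ := scatter load_map hold [:: unread; rightC; rightP] in
  read_names (enum 'I_j).

Definition election_regs (C : seq nat) (V : seq (nat * seq nat)) (W : seq nat) (total : nat)
    (t : reg) : nat :=
  match t with
  | inl i => nth 0 C i
  | inr (inl (a, b, e)) => pref_weight V (nth 0 C a) (nth 0 C b) + (if e then sumn W else 0)
  | inr (inr b) => if b then total else size V + size W
  end.

Definition machines_loaded C rest :=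
  [/\ rest hold = [::], tape_loaded of_symC leftC rightC outC C rest &
      tape_loaded of_symP leftP rightP outP C rest].

Lemma load_candidatesP :
  triple (fun '((C, w) : seq nat * seq letter) s => size C = j /\
     exists2 rest, memory (enc_nats C ++ w) (fun=> 0) rest s & forall k, rest k = [::])
   load_candidates
   (fun '(C, w) _ s => exists2 rest, memory w (election_regs C [::] [::] 0) rest s &
     machines_loaded C rest).
Proof.
apply: (triple_bind (M := fun '((C, w) : seq nat * seq letter) (_ : unit) s => size C = j /\
    exists rest, [/\ memory w (fun=> 0) rest s, rest hold = rev (map of_letter (enc_nats C)) &
      forall k, k != hold -> rest k = [::]])) => [|[]].
  apply: triple_consequence (take_numbersP j) _ => -[C w] s [sC [rest memE rest0]].
  exists (C, (w, fun=> 0, rest, store_size s)) => // _ s' memE'; split=> //.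
  eexists; split; [exact: memE'|by rewrite upd_eq rest0 catrevE cats0|].
  by move=> k ne_k; rewrite upd_neq.
apply: (triple_bind (M := fun '((C, w) : seq nat * seq letter) (_ : unit) s => size C = j /\
    exists2 rest, memory (enc_nats C ++ w) (fun=> 0) rest s & machines_loaded C rest)) => [|[]].
  apply: triple_consequence
    (scatterP load_map (isT : uniq [:: hold; unread; rightC; rightP])) _.
  move=> [C w] s [sC [rest [memE restH rest0]]]; exists s => // _ s' [s'H scattered fr].
  split=> //; have sH : s hold = rev (map of_letter (enc_nats C)).
    by rewrite (memory_at (isT : off_memory hold) memE).
  have [cs [unreadE columnsE scratchE csE fr0]] := memE.
  have sent b : b \in [:: unread; rightC; rightP] ->
      s' b = [seq load_map b (of_letter a) | a <- enc_nats C] ++ s b.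
    by move=> b_in; rewrite scattered // sH map_rev catrevE revK -map_comp.
  exists s'.
    exists cs; rewrite (fr columns) // (fr scratch) // sent ?mem_head // unreadE map_cat.
    by split=> //; exact: frame_refl.
  have still k : off_memory k -> k \notin [:: hold; unread; rightC; rightP] -> s' k = [::].
    move=> k_out k_in; rewrite fr // fr0 // rest0 //; by apply: contraNneq k_in => ->.
  split; first exact: s'H.
    by split; rewrite ?(still leftC) ?(still outC) // sent // fr0 // rest0 // cats0.
  by split; rewrite ?(still leftP) ?(still outP) // sent // fr0 // rest0 // cats0.
apply: triple_consequence (read_namesP (enum 'I_j)) _ => -[C w] s [sC [rest memE loaded]].
exists (C, (w, fun=> 0, rest, store_size s)); first by rewrite map_nth_enum_ord.
move=> _ s' memE'; exists rest => //; apply: memory_eq_regs memE' => t.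
rewrite add0n big_enum /=; case: t => [i|[[[a b] e]|b]] /=.
- rewrite (bigD1 i) //= eqxx big1 ?addn0 // => i' ne_i.
  by case: eqP => // -[iE]; rewrite iE eqxx in ne_i.
- by rewrite big1 // /pref_weight big_nil if_same.
- by rewrite big1 // if_same.
Qed.

Definition tick regs (t : reg) : nat := regs t + (t == seen_reg).

Definition counted_loop (body : prog unit) : prog unit :=
  Iter (fun _ : unit => let* cmp := compare in
    if cmp (total_reg, seen_reg) then break tt else
      let* _ := increment (pred1 seen_reg) in
      let* _ := body in
      continue tt) tt.

Lemma counted_loopP X (D : X -> Prop) (N : X -> nat) (w : X -> nat -> seq letter)
    (regs : X -> nat -> reg -> nat) (rest : X -> store) (body : prog unit) :
  (forall x i, i <= N x -> regs x i total_reg = regs x i seen_reg + (N x - i)) ->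
  (forall x, N x <= size (w x 0)) ->
  triple (fun '((x, i, B) : X * nat * nat) s =>
      [/\ D x, i < N x, memory (w x i) (tick (regs x i)) (rest x) s & store_size s <= B])
    body
    (fun '(x, i, B) _ s => memory (w x i.+1) (regs x i.+1) (rest x) s /\ store_size s <= B) ->
  triple (fun x s => D x /\ memory (w x 0) (regs x 0) (rest x) s)
    (counted_loop body)
    (fun x _ s => D x /\ memory (w x (N x)) (regs x (N x)) (rest x) s).
Proof.
move=> counters le_N bodyP.
pose Inv x m s := D x /\
  exists i, [/\ i <= N x, m = N x - i & memory (w x i) (regs x i) (rest x) s].
apply: (@triple_iter _ _ _ _ _ _ _ _ _ (fun x m (_ : unit) s => Inv x m s) id poly_growth_id).
  move=> x s [dx memE]; exists (N x).
    apply: leq_trans (le_N x) _; have [cs [unreadE _ _ _ _]] := memE.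
    by rewrite -(size_map of_letter) -unreadE leq_store_size.
  by split=> //; exists 0; rewrite subn0.
case; apply: (triple_bind (M :=
  fun '((x, m, n) : X * nat * nat) (cmp : {ffun reg * reg -> bool}) s =>
    cmp (total_reg, seen_reg) = (m == 0) /\ Inv x m s /\ store_size s + m <= n)) => [|cmp].
  apply: triple_consequence compareP _ => -[[x m] n] s [[dx [i [le_i -> memE]]] le_n].
  exists (w x i, regs x i, rest x, n - (N x - i)); first by split=> //; lia.
  move=> r s' [-> memE' le_n']; rewrite ffunE counters //; split.
    by rewrite -[X in _ <= X]addn0 leq_add2l leqn0.
  by split; [split=> //; exists i|lia].
case cmpE: (cmp (total_reg, seen_reg)).
  apply: triple_ret => -[[x m] n] s.
  rewrite cmpE => -[/esym/eqP m0 [[dx [i [le_i mE memE]]] _]]; split=> //.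
  by have -> : N x = i by lia.
apply: (triple_bind (M := fun '((x, m, n) : X * nat * nat) (_ : unit) s => D x /\ exists i,
    [/\ i < N x, m = N x - i, memory (w x i) (tick (regs x i)) (rest x) s &
     store_size s + m <= n.+1]))
    => [|[]].
  apply: triple_consequence (incrementP (pred1 seen_reg)) _.
  move=> [[x m] n] s; rewrite cmpE => -[/esym/eqP m_neq0 [[dx [i [le_i mE memE]]] le_n]].
  exists (w x i, regs x i, rest x, n - m); first by split=> //; lia.
  by move=> _ s' [memE' le_n']; split=> //; exists i; split=> //; lia.
apply: (triple_bind (M := fun '((x, m, n) : X * nat * nat) (_ : unit) s =>
    exists2 m', m' < m & Inv x m' s /\ store_size s + m' <= n)) => [|[]]; last first.
  by apply: triple_ret => -[[x m] n].
apply: triple_consequence bodyP _ => -[[x m] n] s [dx [i [lt_i mE memE le_n]]].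
exists (x, i, n.+1 - m); first by split=> //; lia.
move=> _ s' [memE' le_n']; exists (N x - i.+1); first by lia.
by split; [split=> //; exists i.+1|lia].
Qed.

(** * Reading the votes *)

Definition prefers_mask (ids : seq nat) (t : reg) : bool :=
  if t is inr (inl (a, b, _)) then prefers ids a b else false.

Definition coalition_mask (t : reg) : bool := if t is inr (inl (_, _, e)) then e else false.

Definition read_voter : prog unit :=
  let* _ := take_number to_letter unread hold in
  let* ids := read_positions j in
  let* _ := transfer sym hold unread in
  read_add (prefers_mask (map val ids)) pred0.

Definition read_manipulator : prog unit := read_add coalition_mask pred0.

Lemma prefers_positions (C v : seq nat) (a b : 'I_j) : uniq C -> size C = j -> perm_eq v C ->
  prefers (positions C v) a b = prefers v (nth 0 C a) (nth 0 C b).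
Proof.
move=> uC sC vC; have nth_in (i : 'I_j) : nth 0 C i \in C by rewrite mem_nth ?sC.
have nthK (i : 'I_j) : i = index (nth 0 C i) C :> nat by rewrite index_uniq ?sC.
have v_sub : {subset v <= C} by move=> c; rewrite (perm_mem vC).
rewrite /prefers {1}(nthK a) {1}(nthK b) /positions.
by rewrite !(index_map_in (@index_inj _ 0 C) v_sub).
Qed.

Lemma election_regs_voter C V W total x t : uniq C -> size C = j -> perm_eq x.2 C ->
  election_regs C (rcons V x) W total t =
  tick (election_regs C V W total) t + (if prefers_mask (positions C x.2) t then x.1 else 0).
Proof.
rewrite /tick; case: t => [i|[[[a b] e]|[]]] uC sC vC /=; rewrite ?addn0 //.
  by rewrite prefers_positions // /pref_weight -cats1 big_cat big_seq1 addnAC.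
by rewrite size_rcons addSn addn1.
Qed.

Lemma election_regs_manipulator C V W total n t :
  election_regs C V (rcons W n) total t =
  tick (election_regs C V W total) t + (if coalition_mask t then n else 0).
Proof.
rewrite /tick; case: t => [i|[[[a b] []]|[]]] /=; rewrite ?addn0 //.
  by rewrite -cats1 sumn_cat /= addn0 addnA.
by rewrite size_rcons addnS addn1.
Qed.

Lemma election_regs_add_total C V W total n t :
  election_regs C V W (total + n) t =
  election_regs C V W total t + (if t == total_reg then n else 0).
Proof. by case: t => [i|[[[a b] e]|[]]] /=; rewrite ?addn0. Qed.

Definition voter_input := (seq nat * (nat * seq nat) * ghost)%type.

Lemma read_voterP :
  triple (fun '((C, x, (w, regs, rest, B)) : voter_input) s =>
     [/\ size C = j, names_loaded C regs, perm_eq x.2 C & rest hold = [::]] /\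
     memory (enc_nat x.1 ++ enc_nats x.2 ++ w) regs rest s /\ store_size s <= B)
   read_voter
   (fun '(C, x, (w, regs, rest, B)) _ s =>
     memory w (fun t => regs t + (if prefers_mask (positions C x.2) t then x.1 else 0)) rest s /\
     store_size s <= B).
Proof.
pose lifted (n : nat) rest := upd rest hold (rev (map of_letter (enc_nat n))).
apply: (triple_bind (M := fun '((C, x, (w, regs, rest, B)) : voter_input) (_ : unit) s =>
    [/\ size C = j, names_loaded C regs, perm_eq x.2 C & rest hold = [::]] /\
    memory (enc_nats x.2 ++ w) regs (lifted x.1 rest) s /\ store_size s <= B)) => [|[]].
  apply: triple_consequence take_number_memoryP _ => -[[C x] [[[w regs] rest] B]] s [voter pre].
  exists (x.1, (enc_nats x.2 ++ w, regs, rest, B)) => // _ s' pre'.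
  by split=> //; move: pre'; have [_ _ _ ->] := voter; rewrite catrevE cats0.
apply: (triple_bind (M :=
  fun '((C, x, (w, regs, rest, B)) : voter_input) (t : j.-tuple 'I_j.+1) s =>
    [/\ map val t = positions C x.2, rest hold = [::], memory w regs (lifted x.1 rest) s &
      store_size s <= B])) => [|t].
  apply: triple_consequence (read_positionsP j) _.
  move=> [[C x] [[[w regs] rest] B]] s [[sC loaded vC restH] pre].
  exists (C, x.2, (w, regs, lifted x.1 rest, B)); first by rewrite (perm_size vC).
  by move=> t s' [tE memE le_B].
apply: (triple_bind (M := fun '((C, x, (w, regs, rest, B)) : voter_input) (_ : unit) s =>
    map val t = positions C x.2 /\
    memory (enc_nat x.1 ++ w) regs rest s /\ store_size s <= B)) => [|[]].
  apply: triple_consequence (return_to_inputP (isT : off_memory hold)) _.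
  move=> [[C x] [[[w regs] rest] B]] s [tE restH memE le_B].
  exists (enc_nat x.1, (w, regs, lifted x.1 rest, B)); first by rewrite /lifted upd_eq.
  move=> _ s' pre; split=> //; suff <- : upd (lifted x.1 rest) hold [::] = rest by [].
  by apply/ffunP=> k; rewrite !updE; case: eqP => // ->.
apply: triple_consequence (read_addP _ _) _.
move=> [[C x] [[[w regs] rest] B]] s [tE pre]; exists (x.1, (w, regs, rest, B)) => // _ s'.
rewrite tE => -[memE le_B]; split=> //; apply: memory_eq_regs memE => r; exact: addn0.
Qed.

Definition voters_input := (seq nat * seq (nat * seq nat) * seq letter * store)%type.

Lemma read_votersP :
  triple (fun '((C, V, w, rest) : voters_input) s =>
     [/\ uniq C, size C = j, votes_over C V & rest hold = [::]] /\
     memory (enc_voters V ++ w) (election_regs C [::] [::] (size V)) rest s)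
   (counted_loop read_voter)
   (fun '(C, V, w, rest) _ s => memory w (election_regs C V [::] (size V)) rest s).
Proof.
pose D : voters_input -> Prop := fun '(C, V, w, rest) =>
  [/\ uniq C, size C = j, votes_over C V & rest hold = [::]].
pose N : voters_input -> nat := fun '(C, V, w, rest) => size V.
pose input : voters_input -> nat -> seq letter :=
  fun '(C, V, w, rest) i => enc_voters (drop i V) ++ w.
pose regs : voters_input -> nat -> reg -> nat :=
  fun '(C, V, w, rest) i => election_regs C (take i V) [::] (size V).
pose other : voters_input -> store := fun '(C, V, w, rest) => rest.
apply: triple_consequence (@counted_loopP _ D N input regs other read_voter _ _ _) _.
- move=> [[[C V] w] rest] i /= le_i; rewrite size_takel //; lia.
- move=> [[[C V] w] rest] /=; rewrite drop0 size_cat.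
  exact: leq_trans (leq_size_enc_voters V) (leq_addr _ _).
- apply: triple_consequence read_voterP _.
  move=> [[[[[C V] w] rest] i] B] s /= [[uC sC votesV restH] lt_i memE le_B].
  pose x := nth (0, [::]) V i; have xV : x \in V by rewrite mem_nth.
  have vC := allP votesV x xV.
  exists (C, x, (enc_voters (drop i.+1 V) ++ w,
    tick (election_regs C (take i V) [::] (size V)), rest, B)).
    split; first by split=> //; move=> r; rewrite /tick addn0.
    by move: memE; rewrite (drop_nth (0, [::])) // enc_voters_cons -!catA.
  move=> _ s' [memE' le_B']; split=> //; apply: memory_eq_regs memE' => t.
  by rewrite (take_nth (0, [::])) // election_regs_voter.
move=> [[[C V] w] rest] s pre; exists (C, V, w, rest).
  by rewrite /= drop0 take0; case: pre.
by move=> _ s' /= [_]; rewrite take_size drop_size.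
Qed.

Definition manipulators_input :=
  (seq nat * seq (nat * seq nat) * seq nat * seq letter * store)%type.

Lemma read_manipulatorsP :
  triple (fun '((C, V, W, w, rest) : manipulators_input) s =>
     memory (enc_nats W ++ w) (election_regs C V [::] (size V + size W)) rest s)
   (counted_loop read_manipulator)
   (fun '(C, V, W, w, rest) _ s => memory w (election_regs C V W (size V + size W)) rest s).
Proof.
pose N : manipulators_input -> nat := fun '(C, V, W, w, rest) => size W.
pose input : manipulators_input -> nat -> seq letter :=
  fun '(C, V, W, w, rest) i => enc_nats (drop i W) ++ w.
pose regs : manipulators_input -> nat -> reg -> nat :=
  fun '(C, V, W, w, rest) i => election_regs C V (take i W) (size V + size W).
pose other : manipulators_input -> store := fun '(C, V, W, w, rest) => rest.
apply: triple_consequence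
  (@counted_loopP _ (fun=> True) N input regs other read_manipulator _ _ _) _.
- move=> [[[[C V] W] w] rest] i /= le_i; rewrite size_takel //; lia.
- move=> [[[[C V] W] w] rest] /=; rewrite drop0 size_cat.
  exact: leq_trans (leq_size_enc_nats W) (leq_addr _ _).
- apply: triple_consequence (read_addP _ _) _.
  move=> [[[[[[C V] W] w] rest] i] B] s /= [_ lt_i memE le_B].
  exists (nth 0 W i, (enc_nats (drop i.+1 W) ++ w,
    tick (election_regs C V (take i W) (size V + size W)), rest, B)).
    by split=> //; move: memE; rewrite (drop_nth 0) // enc_nats_cons -catA.
  move=> _ s' [memE' le_B']; split=> //; apply: memory_eq_regs memE' => t.
  by rewrite addn0 (take_nth 0) // election_regs_manipulator.
move=> [[[[C V] W] w] rest] s pre; exists (C, V, W, w, rest); first by rewrite /= drop0 take0.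
by move=> _ s' /= [_]; rewrite take_size drop_size.
Qed.

(** * Summarizing an instance *)

Definition enc_profile (x : inst) : seq letter :=
  enc_nat (size (ivoters x)) ++ enc_voters (ivoters x) ++
  enc_nat (size (imanip x)) ++ enc_nats (imanip x).

Definition name_regs (x : inst) : reg -> nat := election_regs (icands x) [::] [::] 0.

Definition profile_regs (x : inst) : reg -> nat :=
  election_regs (icands x) (ivoters x) (imanip x) (size (ivoters x) + size (imanip x)).

Definition read_profile : prog {ffun reg * reg -> bool} :=
  let* _ := read_add (pred1 total_reg) pred0 in
  let* _ := counted_loop read_voter in
  let* _ := read_add (pred1 total_reg) pred0 in
  let* _ := counted_loop read_manipulator in
  compare.

Lemma add_totalP :
  triple (fun '((n, C, V, (w, total, rest)) :
      nat * seq nat * seq (nat * seq nat) * (seq letter * nat * store)) s =>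
     memory (enc_nat n ++ w) (election_regs C V [::] total) rest s)
   (read_add (pred1 total_reg) pred0)
   (fun '(n, C, V, (w, total, rest)) _ s =>
     memory w (election_regs C V [::] (total + n)) rest s).
Proof.
apply: triple_consequence (read_addP _ _) _ => -[[[n C] V] [[w total] rest]] s memE.
exists (n, (w, election_regs C V [::] total, rest, store_size s)) => // _ s' [memE' _].
by apply: memory_eq_regs memE' => t; rewrite election_regs_add_total addn0.
Qed.

Lemma read_profileP :
  triple (fun '((x, rest) : inst * store) s => [/\ wf_inst j x, rest hold = [::] &
     memory (enc_profile x) (name_regs x) rest s])
   read_profile
   (fun '(x, rest) cmp s => cmp = [ffun p => profile_regs x p.1 <= profile_regs x p.2]).
Proof.
pose after_voters x := enc_nat (size (imanip x)) ++ enc_nats (imanip x).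
apply: (triple_bind (M := fun '((x, rest) : inst * store) (_ : unit) s =>
    [/\ wf_inst j x, rest hold = [::] & memory (enc_voters (ivoters x) ++ after_voters x)
     (election_regs (icands x) [::] [::] (size (ivoters x))) rest s])) => [|[]].
  apply: triple_consequence add_totalP _ => -[x rest] s [wf restH memE].
  by exists (size (ivoters x), icands x, [::],
    (enc_voters (ivoters x) ++ after_voters x, 0, rest)).
apply: (triple_bind (M := fun '((x, rest) : inst * store) (_ : unit) s =>
    memory (after_voters x)
      (election_regs (icands x) (ivoters x) [::] (size (ivoters x))) rest s)) => [|[]].
  apply: triple_consequence read_votersP _ => -[x rest] s [[uC sC votesV _] restH memE].
  by exists (icands x, ivoters x, after_voters x, rest).
apply: (triple_bind (M := fun '((x, rest) : inst * store) (_ : unit) s =>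
    memory (enc_nats (imanip x)) (election_regs (icands x) (ivoters x) [::]
      (size (ivoters x) + size (imanip x))) rest s)) => [|[]].
  apply: triple_consequence add_totalP _ => -[x rest] s memE.
  by exists (size (imanip x), icands x, ivoters x,
    (enc_nats (imanip x), size (ivoters x), rest)).
apply: (triple_bind (M := fun '((x, rest) : inst * store) (_ : unit) s =>
    memory [::] (profile_regs x) rest s)) => [|[]].
  apply: triple_consequence read_manipulatorsP _ => -[x rest] s memE.
  by exists (icands x, ivoters x, imanip x, [::], rest); rewrite ?cats0.
apply: triple_consequence compareP _ => -[x rest] s memE.
by exists ([::], profile_regs x, rest, store_size s) => // cmp s' [].
Qed.

Definition flat_pairs (s : seq (nat * nat)) : seq nat := flatten [seq [:: x.1; x.2] | x <- s].

Definition tie_breaks : finType := (j.-tuple 'I_j.+1 * (j * j.-1).-tuple 'I_j.+1)%type.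

Definition summary : finType := (tie_breaks * 'I_j.+1 * {ffun reg * reg -> bool})%type.

Definition open_input : prog column :=
  let* _ := transfer sym hold unread in read_match.

Definition read_tie_breaks : prog tie_breaks :=
  let* oC := read_tie_break of_symC to_symC leftC rightC outC j in
  let* oP := read_tie_break of_symP to_symP leftP rightP outP (j * j.-1) in
  Ret ((oC, oP) : tie_breaks).

Definition summarize : prog summary :=
  let* _ := open_input in
  let* _ := load_candidates in
  let* orders := read_tie_breaks in
  let* p := read_position in
  let* cmp := read_profile in
  Ret ((orders, p, cmp) : summary).

Section Summary.
Variables (tbC : seq nat -> seq nat) (tbP : seq nat -> seq (nat * nat)).

Definition encodes_tie_breaks (C : seq nat) (orders : tie_breaks) : Prop :=
  map val orders.1 = positions C (tbC C) /\
  map val orders.2 = positions C (flat_pairs (tbP C)).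

Definition summarizes (x : inst) (sg : summary) : Prop :=
  let: (orders, p, cmp) := sg in
  [/\ encodes_tie_breaks (icands x) orders, p = index (idist x) (icands x) :> nat &
      cmp = [ffun q => profile_regs x q.1 <= profile_regs x q.2]].

Variables TC TP : nat -> nat.
Hypotheses (pTC : poly_growth TC) (pTP : poly_growth TP).
Hypothesis runC : forall C, uniq C ->
  runs_to MC (enc_nats C) (enc_nats (tbC C)) (TC (size (enc_nats C))).
Hypothesis runP : forall C, uniq C ->
  runs_to MP (enc_nats C) (enc_pairs (tbP C)) (TP (size (enc_nats C))).
Hypothesis size_tbC : forall C, uniq C -> size (tbC C) = size C.
Hypothesis size_tbP : forall C, uniq C -> size (flat_pairs (tbP C)) = size C * (size C).-1.

Lemma open_inputP :
  triple (fun x s => wf_inst j x /\ s = input_store hold of_letter (enc_inst x))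
    open_input
    (fun x _ s => wf_inst j x /\ exists2 rest,
      memory (enc_nats (icands x) ++ enc_nat (idist x) ++ enc_profile x) (fun=> 0) rest s &
      forall k, rest k = [::]).
Proof.
pose empty : store := [ffun=> [::]].
apply: (triple_bind (M := fun x (_ : unit) s =>
    wf_inst j x /\ memory (enc_inst x) (fun=> 0) empty s)) => [|[]].
  apply: triple_consequence (return_to_inputP (isT : off_memory hold)) _ => x s [wf ->].
  set s0 := input_store _ _ _; exists (enc_inst x, ([::], fun=> 0, s0, store_size s0)).
    split=> //; first by rewrite ffunE eqxx.
    by exists [::]; rewrite !ffunE; split=> //; exact: frame_refl.
  have <- : upd s0 hold [::] = empty by apply/ffunP=> k; rewrite !ffunE; case: eqP.
  by rewrite cats0 => _ s' [memE _].
apply: triple_consequence read_matchP _ => x s [wf memE].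
exists (size (icands x), (enc_nats (icands x) ++ enc_nat (idist x) ++ enc_profile x,
  fun=> 0, empty, store_size s)); first by rewrite enc_instE in memE.
by move=> r s' [_ memE' _]; split=> //; exists empty => // k; rewrite ffunE.
Qed.

Lemma read_tie_breaksP :
  triple (fun '((x, w) : inst * seq letter) s => wf_inst j x /\
     exists2 rest, memory w (name_regs x) rest s & machines_loaded (icands x) rest)
   read_tie_breaks
   (fun '(x, w) orders s => encodes_tie_breaks (icands x) orders /\
     exists2 rest, memory w (name_regs x) rest s & rest hold = [::]).
Proof.
apply: (triple_bind (M := fun '((x, w) : inst * seq letter) (oC : j.-tuple 'I_j.+1) s =>
    [/\ wf_inst j x, map val oC = positions (icands x) (tbC (icands x)) &
      exists rest, [/\ memory w (name_regs x) rest s, rest hold = [::] &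
        tape_loaded of_symP leftP rightP outP (icands x) rest]])) => [|oC].
  apply: triple_consequence (@read_tie_breakP MC of_symC to_symC (fun=> erefl) leftC rightC outC
    isT isT isT isT j tbC TC pTC) _.
  move=> [x w] s [wf [rest memE [restH loadedC [restL restR restO]]]].
  have [uC sC _ _] := wf; exists (icands x, (w, name_regs x, rest)).
    by split=> //; split; rewrite ?size_tbC //; exact: runC.
  move=> oC s' [oCE [rest' memE' fr]]; split=> //; exists rest'.
  by split=> //; [rewrite fr|split; rewrite fr].
apply: (triple_bind (M :=
  fun '((x, w) : inst * seq letter) (oP : (j * j.-1).-tuple 'I_j.+1) s =>
    encodes_tie_breaks (icands x) (oC, oP) /\
    exists2 rest, memory w (name_regs x) rest s & rest hold = [::])) => [|oP].
  apply: triple_consequence (@read_tie_breakP MP of_symP to_symP (fun=> erefl) leftP rightP outP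
    isT isT isT isT (j * j.-1) (fun C => flat_pairs (tbP C)) TP pTP) _.
  move=> [x w] s [wf oCE [rest [memE restH loadedP]]].
  have [uC sC _ _] := wf; exists (icands x, (w, name_regs x, rest)).
    by split=> //; split; rewrite ?size_tbP ?sC //; exact: runP.
  by move=> oP s' [oPE [rest' memE' fr]]; split=> //; exists rest'; rewrite ?fr.
by apply: triple_ret => -[x w].
Qed.

Lemma summarizeP :
  triple (fun x s => wf_inst j x /\ s = input_store hold of_letter (enc_inst x)) summarize
    (fun x sg _ => summarizes x sg).
Proof.
pose enc_rest x := enc_nat (idist x) ++ enc_profile x.
apply: (triple_bind open_inputP) => _.
apply: (triple_bind (M := fun x (_ : unit) s => wf_inst j x /\
    exists2 rest, memory (enc_rest x) (name_regs x) rest s & machines_loaded (icands x) rest))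
    => [|[]].
  apply: triple_consequence load_candidatesP _ => x s [wf pre].
  by exists (icands x, enc_rest x); first by case: (wf).
apply: (triple_bind (M := fun x orders s =>
    [/\ wf_inst j x, encodes_tie_breaks (icands x) orders &
      exists2 rest, memory (enc_rest x) (name_regs x) rest s & rest hold = [::]])) => [|orders].
  apply: triple_consequence read_tie_breaksP _ => x s pre.
  by exists (x, enc_rest x) => // orders s'; case: pre => wf _ [].
apply: (triple_bind (M := fun x (p : 'I_j.+1) s =>
    [/\ wf_inst j x, encodes_tie_breaks (icands x) orders,
      p = index (idist x) (icands x) :> nat &
      exists2 rest, memory (enc_profile x) (name_regs x) rest s & rest hold = [::]])) => [|p].
  apply: triple_consequence read_positionP _ => x s [wf ordersE [rest memE restH]].
  exists (icands x, idist x, (enc_profile x, name_regs x, rest, store_size s)).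
    by case: (wf).
  by move=> p s' [pE memE' _]; split=> //; exists rest.
apply: (triple_bind (M := fun x (cmp : {ffun reg * reg -> bool}) s =>
    summarizes x (orders, p, cmp))) => [|cmp]; last by apply: triple_ret.
apply: triple_consequence read_profileP _ => x s [wf ordersE pE [rest memE restH]].
by exists (x, rest).
Qed.

End Summary.

End ElectionProgram.

(** * The summary determines the outcome *)

Lemma flat_pairs_map (f : nat -> nat) (s : seq (nat * nat)) :
  flat_pairs [seq (f x.1, f x.2) | x <- s] = map f (flat_pairs s).
Proof. by elim: s => //= x s; rewrite /flat_pairs /= => ->. Qed.

Lemma flat_pairs_inj : injective flat_pairs.
Proof.
elim=> [|[a b] s IH] [|[c d] s'] //; rewrite /flat_pairs /=.
by case=> -> -> /IH ->.
Qed.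

Lemma size_flat_pairs C ordC ordP : tie_orders C ordC ordP ->
  size (flat_pairs ordP) = size C * (size C).-1.
Proof.
case=> uC _ pP; have : size ordP = 'C(size C, 2).
  by rewrite -size_allupairs // -(perm_size pP) size_map.
have -> : size (flat_pairs ordP) = size ordP * 2.
  by elim: (ordP) => //= x s; rewrite /flat_pairs /= => ->; rewrite mulSn.
by move->; rewrite mulnC mul_bin_left bin1 subn1 mulnC.
Qed.

Lemma flat_pairs_sub C ordC ordP : tie_orders C ordC ordP -> {subset flat_pairs ordP <= C}.
Proof.
case=> _ _ pP c /flattenP[l /mapP[[a b] ab ->]].
have [aC bC] : a \in C /\ b \in C by apply: mem_upair_sub; rewrite -(perm_mem pP) map_f.
by rewrite !inE => /orP[] /eqP ->.
Qed.

Section Renaming.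
Variables (C C' : seq nat).
Hypotheses (uC : uniq C) (uC' : uniq C') (sizeCC' : size C' = size C).

Definition rename c := nth 0 C' (index c C).

Lemma map_rename : map rename C = C'.
Proof.
apply: (@eq_from_nth _ 0) => [|i]; rewrite size_map // => lt_i.
by rewrite (nth_map 0) // /rename index_uniq.
Qed.

Lemma rename_in c : c \in C -> rename c \in C'.
Proof. by move=> cC; rewrite -map_rename map_f. Qed.

Lemma index_rename c : c \in C -> index (rename c) C' = index c C.
Proof. by move=> cC; rewrite /rename index_uniq // sizeCC' index_mem. Qed.

Lemma rename_inj : {in C &, injective rename}.
Proof.
by move=> a b aC bC ab; apply: (@index_inj _ 0 C) => //; rewrite -!index_rename // ab.
Qed.

Lemma rename_positions s s' : {subset s' <= C'} -> positions C s = positions C' s' ->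
  s' = map rename s.
Proof.
move=> sub posE; rewrite /rename (map_comp (nth 0 C') (index^~ C)) -/(positions C s) posE.
by rewrite -map_comp -[LHS]map_id; apply/eq_in_map => c /sub cC' /=; rewrite nth_index.
Qed.

Variables (ordC ordC' : seq nat) (ordP ordP' : seq (nat * nat)) (E E' : seq (nat * seq nat)).
Hypotheses (orders : tie_orders C ordC ordP) (orders' : tie_orders C' ordC' ordP').
Hypothesis same_ordC : positions C ordC = positions C' ordC'.
Hypothesis same_ordP : positions C (flat_pairs ordP) = positions C' (flat_pairs ordP').
Hypotheses (votesE : votes_over C E) (votesE' : votes_over C' E').
Hypothesis same_weight_order : forall a b c d, a \in C -> b \in C -> c \in C -> d \in C ->
  (pref_weight E' (rename a) (rename b) <= pref_weight E' (rename c) (rename d)) =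
  (pref_weight E a b <= pref_weight E c d).

Lemma rename_ordC : ordC' = map rename ordC.
Proof. by apply: rename_positions => // c; case: orders' => _ /perm_mem ->. Qed.

Lemma rename_ordP : ordP' = [seq (rename x.1, rename x.2) | x <- ordP].
Proof.
apply: flat_pairs_inj; rewrite flat_pairs_map; apply: rename_positions same_ordP.
exact: flat_pairs_sub orders'.
Qed.

Lemma rename_neq a b : a \in C -> b \in C -> a != b -> rename a != rename b.
Proof. by move=> aC bC; apply: contra_neq; apply: rename_inj. Qed.

Lemma pairpos_rename a b : a \in C -> b \in C ->
  rp_pairpos ordP' (rename a, rename b) = rp_pairpos ordP (a, b).
Proof.
move=> aC bC; rewrite /rp_pairpos rename_ordP -map_comp.
have : {in ordP, forall x, x.1 \in C /\ x.2 \in C}.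
  move=> [x y] xy; case: orders => _ _ pP.
  by apply: (@mem_upair_sub C); rewrite -(perm_mem pP) map_f.
elim: (ordP) => //= [[x y] s IH] sub.
rewrite IH => [|z zs]; last by apply: sub; rewrite inE zs orbT.
have [/= xC yC] := sub (x, y) (mem_head _ _).
congr (if _ then _ else _); apply/eqP/eqP => /upair_eq /=.
  by case=> -[/rename_inj e1 /rename_inj e2]; rewrite e1 // e2 // upairC.
by case=> -[-> ->] //; rewrite upairC.
Qed.

Lemma wmg_le_rename a b c d : a \in C -> b \in C -> a != b -> c \in C -> d \in C -> c != d ->
  (wmg E' (rename a) (rename b) <= wmg E' (rename c) (rename d))%R = (wmg E a b <= wmg E c d)%R.
Proof.
move=> aC bC ab cC dC cd.
by rewrite (wmg_le votesE) // (wmg_le votesE') ?rename_in ?rename_neq // same_weight_order.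
Qed.

Lemma directed_rename a b : a \in C -> b \in C -> a != b ->
  directed E' ordC' (rename a) (rename b) = directed E ordC a b.
Proof.
move=> aC bC ab; have ba : b != a by rewrite eq_sym.
have sub : {subset ordC <= C} by case: orders => _ /perm_mem ordC_mem _ c; rewrite ordC_mem.
have directedE F o x y : directed F o x y = ~~ (wmg F x y <= wmg F y x)%R ||
    [&& (wmg F x y <= wmg F y x)%R, (wmg F y x <= wmg F x y)%R & index x o < index y o].
  by rewrite /directed (wmgN F x y); lia.
by rewrite !directedE !wmg_le_rename // rename_ordC !(index_map_in rename_inj sub).
Qed.

Lemma before_rename a b c d : a \in C -> b \in C -> a != b -> c \in C -> d \in C -> c != d ->
  rp_before E' ordP' (rename a, rename b) (rename c, rename d) = rp_before E ordP (a, b) (c, d).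
Proof.
move=> aC bC ab cC dC cd; have [ba dc] : b != a /\ d != c by rewrite (eq_sym b) (eq_sym d).
rewrite /rp_before !pairpos_rename // !ltNge !eq_le /rp_strength /= !ge_max !le_max.
by rewrite !wmg_le_rename.
Qed.

Lemma stack_ranking_rename L : stack_ranking C E ordC ordP L ->
  stack_ranking C' E' ordC' ordP' (map rename L).
Proof.
apply: stack_ranking_map; [exact: rename_inj|by rewrite map_rename|exact: directed_rename|].
exact: before_rename.
Qed.

End Renaming.

(** * The decision procedure *)

Section Decision.
Variables (tbC : seq nat -> seq nat) (tbP : seq nat -> seq (nat * nat)) (j : nat).
Hypothesis permC : forall C : seq nat, uniq C -> perm_eq (tbC C) C.
Hypothesis permP : forall C : seq nat, uniq C -> perm_eq (map upair (tbP C)) (allupairs C).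
Variable m : winner_model.

Let tie_breaks C : uniq C -> tie_orders C (tbC C) (tbP C).
Proof. by move=> uC; split=> //; [apply: permC|apply: permP]. Qed.

Definition unanimous_election (x : inst) (L : seq nat) := ivoters x ++ unanimous (imanip x) L.

Definition self_consistent (x : inst) (L : seq nat) :=
  stack_ranking (icands x) (unanimous_election x L) (tbC (icands x)) (tbP (icands x)) L.

Lemma manipulable_self_consistent x : wf_inst j x ->
  manipulable tbC tbP m x <-> exists2 L, self_consistent x L & ohead L = Some (idist x).
Proof.
case=> uC _ _ _; have orders := tie_breaks uC.
have winsE E L : stack_ranking (icands x) E (tbC (icands x)) (tbP (icands x)) L ->
    let ws := rp_winners (icands x) E (tbC (icands x)) (tbP (icands x)) in
    match m with NonUnique => idist x \in ws | Unique => ws = [:: idist x] end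
    <-> ohead L = Some (idist x).
  move=> stackL; rewrite /= (rp_winners_stack orders stackL).
  case: m; case: L {stackL} => [|w L] //=; rewrite take0.
    by rewrite inE; split=> [/eqP->|[->]].
  by split=> -[->].
split=> [[Wv [sW votesW win]]|[L stackL headL]].
  exists (rp_ranking (icands x) (ivoters x ++ zip (imanip x) Wv)
    (tbC (icands x)) (tbP (icands x))).
    exact: rp_ranking_unanimous.
  exact/(winsE _ _ (rp_ranking_stack _ orders)).
exists (nseq (size (imanip x)) L); split; [exact: size_nseq| |exact/(winsE _ L)].
by apply/allP=> v /nseqP[-> _]; case: stackL.
Qed.

Lemma unanimous_election_over x L : wf_inst j x -> perm_eq L (icands x) ->
  votes_over (icands x) (unanimous_election x L).
Proof.
by case=> _ _ votesV _ LC; rewrite /votes_over all_cat votesV; apply: unanimous_over.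
Qed.

Lemma pref_weight_unanimous_election x L (a b : 'I_j) :
  pref_weight (unanimous_election x L) (nth 0 (icands x) a) (nth 0 (icands x) b) =
  profile_regs x (weight_reg a b (prefers L (nth 0 (icands x) a) (nth 0 (icands x) b))).
Proof. by rewrite pref_weight_cat pref_weight_unanimous. Qed.

Lemma pref_weight_le_rename x y L : wf_inst j x -> wf_inst j y -> perm_eq L (icands x) ->
  (forall p q : reg j,
    (profile_regs y p <= profile_regs y q) = (profile_regs x p <= profile_regs x q)) ->
  let f := rename (icands x) (icands y) in
  forall a b c d, a \in icands x -> b \in icands x -> c \in icands x -> d \in icands x ->
  (pref_weight (unanimous_election y (map f L)) (f a) (f b) <=
   pref_weight (unanimous_election y (map f L)) (f c) (f d)) =
  (pref_weight (unanimous_election x L) a b <= pref_weight (unanimous_election x L) c d).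
Proof.
move=> [uC sC _ _] [uC' sC' _ _] LC same_le f a b c d aC bC cC dC.
have f_inj : {in icands x &, injective f} by apply: rename_inj; rewrite ?sC.
have L_sub : {subset L <= icands x} by move=> e; rewrite (perm_mem LC).
have prefers_f e e' : e \in icands x -> e' \in icands x ->
    prefers (map f L) (f e) (f e') = prefers L e e'.
  by move=> eC e'C; rewrite /prefers !(index_map_in f_inj L_sub).
have lt_j e : e \in icands x -> index e (icands x) < j by rewrite -sC index_mem.
pose i e eC : 'I_j := Ordinal (lt_j e eC).
have weight_x e e' (eC : e \in icands x) (e'C : e' \in icands x) :
    pref_weight (unanimous_election x L) e e' =
    profile_regs x (weight_reg (i e eC) (i e' e'C) (prefers L e e')).
  by have := pref_weight_unanimous_election x L (i e eC) (i e' e'C); rewrite /= !nth_index.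
have weight_y e e' (eC : e \in icands x) (e'C : e' \in icands x) :
    pref_weight (unanimous_election y (map f L)) (f e) (f e') =
    profile_regs y (weight_reg (i e eC) (i e' e'C) (prefers L e e')).
  by rewrite -prefers_f // -(pref_weight_unanimous_election y (map f L) (i e eC) (i e' e'C)).
rewrite (weight_x a b aC bC) (weight_x c d cC dC).
by rewrite (weight_y a b aC bC) (weight_y c d cC dC) same_le.
Qed.

Lemma summary_determines_manipulable x y (sg : summary j) : wf_inst j x -> wf_inst j y ->
  summarizes tbC tbP x sg -> summarizes tbC tbP y sg ->
  manipulable tbC tbP m x -> manipulable tbC tbP m y.
Proof.
case: sg => [[[oC oP] p] cmp] wfx wfy [[oCx oPx] px cmpx] [[oCy oPy] py cmpy].
case/(manipulable_self_consistent wfx) => L stackL headL.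
have [[uC sC votesV dC] [uC' sC' votesV' dC']] := (wfx, wfy).
have [LC _] := stackL; pose f := rename (icands x) (icands y).
have sizeCC' : size (icands y) = size (icands x) by rewrite sC.
apply/(manipulable_self_consistent wfy); exists (map f L); last first.
  case: L headL {stackL LC} => //= c L [->]; congr Some.
  by rewrite /f /rename -px py nth_index.
apply: (stack_ranking_rename _ _ _ (tie_breaks uC) (tie_breaks uC') _ _ _ _ _ stackL) => //.
- by rewrite -[LHS]oCx -[RHS]oCy.
- by rewrite -[LHS]oPx -[RHS]oPy.
- exact: unanimous_election_over.
- apply: unanimous_election_over => //.
  by rewrite -(map_rename uC sizeCC'); apply: perm_map.
- apply: pref_weight_le_rename => // q r; move: cmpx; rewrite cmpy => /ffunP/(_ (q, r)).
  by rewrite !ffunE.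
Qed.

Lemma ranked_pairs_decidable :
  poly_computable (fun C : seq nat => uniq C) enc_nats enc_nats tbC ->
  poly_computable (fun C : seq nat => uniq C) enc_nats enc_pairs tbP ->
  poly_decidable (wf_inst j) enc_inst (manipulable tbC tbP m).
Proof.
move=> [MC [c [k runC]]] [MP [c' [k' runP]]].
have polyT a b : poly_growth (fun n => a * n ^ b + a).
  apply: poly_growthD _ (poly_growth_const a); apply: (poly_growthM (poly_growth_const a)).
  exact: poly_growthX poly_growth_id.
have size_tbC C : uniq C -> size (tbC C) = size C by move=> /permC/perm_size.
have size_tbP C : uniq C -> size (flat_pairs (tbP C)) = size C * (size C).-1.
  by move=> uC; apply: size_flat_pairs (tie_breaks uC).
apply: finite_summary_decidable _ summary_determines_manipulable.
exact: summarizeP (polyT c k) (polyT c' k') runC runP size_tbC size_tbP.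
Qed.

End Decision.

Theorem theorem17 (tbC : seq nat -> seq nat) (tbP : seq nat -> seq (nat * nat)) :
  (forall C : seq nat, uniq C -> perm_eq (tbC C) C) ->
  (forall C : seq nat, uniq C -> perm_eq (map upair (tbP C)) (allupairs C)) ->
  poly_computable (fun C : seq nat => uniq C) enc_nats enc_nats tbC ->
  poly_computable (fun C : seq nat => uniq C) enc_nats enc_pairs tbP ->
  forall j : nat, j < 5 ->
    poly_decidable (wf_inst j) enc_inst (manipulable tbC tbP NonUnique) /\
    poly_decidable (wf_inst j) enc_inst (manipulable tbC tbP Unique).
Proof.
move=> permC permP compC compP j _.
by split; apply: (ranked_pairs_decidable j permC permP _ compC compP).
Qed.
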